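(* Given a dictionary $\mathcal{D} = \{d_1,d_2,\ldots,d_K\}$ of strings over an alphabet $\Sigma$ with $|\Sigma| = \mathcal{O}(1)$ and a straight-line program (SLP) $G = (V,\Sigma,R,S)$ generating a string $w \in \Sigma^N$, the Word Break problem on $(w,\mathcal{D})$ can be solved in $\mathcal{O}(M + |G|\, m^{\omega})$ time, where $M = \sum_{i=1}^{K}|d_i|$ and $m = \max_{i=1}^{K}|d_i|$.
   Context: Word Break problem: given a string $w$ and a dictionary $\mathcal{D}$ (a finite set of strings), decide whether $w$ can be partitioned into words from $\mathcal{D}$, i.e., whether there is a factorization $w = f_1 f_2 \cdots f_{\ell}$ with $f_t \in \mathcal{D}$ for every $t \in \{1,\ldots,\ell\}$. A straight-line grammar (SLG) is a context-free grammar $G = (V,\Sigma,R,S)$ ($V$ the finite set of nonterminals, $\Sigma$ the terminals, $R \subseteq V \times (V \cup \Sigma)^*$ the productions, $S \in V$ the start symbol) whose language $L(G)$ consists of exactly one string and in which every nonterminal occurs in some string derived from $S$. Each nonterminal $v$ then has a unique production, whose right-hand side is denoted $\mathrm{rhs}(v)$. An SLP is an SLG in which for every $v \in V$ either $\mathrm{rhs}(v) = ab$ with $a,b \in V$, or $\mathrm{rhs}(v) = a$ with $a \in \Sigma$. $G$ generates $w$ if $L(G) = \{w\}$. The size is $|G| = \sum_{v \in V} |\mathrm{rhs}(v)|$. $\omega \geq 2$ is the matrix multiplication exponent: a constant such that two $n \times n$ matrices can be multiplied in $\mathcal{O}(n^{\omega})$ time (used for Boolean matrices over the $(\lor,\land)$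 semiring). *)

(* Defs.v *)
From Stdlib Require Import Reals List Arith Bool Relations.
Import ListNotations.

(** * Word RAM

    Words are the naturals below [2 ^ W].  A program is a fixed piece of
    structured code; it mentions finitely many registers and finitely many
    arrays, each array being addressed by a word.  (Finitely many arrays fold
    into a single memory by interleaving addresses, and structured control
    simulates jumps, both at a constant factor in time.)  The word size [W] is
    a parameter of the execution, not of the program. *)

Inductive binop : Set :=
| OAdd | OSub | OMul | ODiv | OMod | OAnd | OOr | OXor | OShl | OShr | OLt | OEq.

Inductive prog : Set :=
| Skip
| Const (x k : nat)
| Move (x y : nat)
| Op (o : binop) (x y z : nat)      (* x := y o z *)
| Get (x a y : nat)                 (* x := a[y] *)
| Put (a y x : nat)                (* a[y] := x *)
| Seq (p q : prog)
| If (x : nat) (p q : prog)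
| While (x : nat) (p : prog).

Record state : Type := State {
  reg : nat -> nat;
  arr : nat -> nat -> nat
}.

(* Wrap-around arithmetic; [OLt] and [OEq] return 0 or 1; the Stdlib conventions
   [x / 0 = 0] and [x mod 0 = x] make every operation total. *)
Definition eval_op (W : nat) (o : binop) (x y : nat) : nat :=
  match o with
  | OAdd => x + y
  | OSub => x + 2 ^ W - y
  | OMul => x * y
  | ODiv => x / y
  | OMod => x mod y
  | OAnd => Nat.land x y
  | OOr => Nat.lor x y
  | OXor => Nat.lxor x y
  | OShl => Nat.shiftl x y
  | OShr => Nat.shiftr x y
  | OLt => Nat.b2n (x <? y)
  | OEq => Nat.b2n (x =? y)
  end mod 2 ^ W.

Definition upd {A : Type} (f : nat -> A) (i : nat) (v : A) : nat -> A :=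
  fun j => if j =? i then v else f j.

Definition set_reg (st : state) (x v : nat) : state :=
  State (upd (reg st) x v) (arr st).

Definition set_arr (st : state) (a i v : nat) : state :=
  State (reg st) (upd (arr st) a (upd (arr st a) i v)).

(* [exec W p st t st']: started in [st], [p] halts in [st'] after exactly [t]
   steps; basic instructions and tests of a guard cost one step each. *)
Inductive exec (W : nat) : prog -> state -> nat -> state -> Prop :=
| ESkip st : exec W Skip st 1 st
| EConst st x k : exec W (Const x k) st 1 (set_reg st x (k mod 2 ^ W))
| EMove st x y : exec W (Move x y) st 1 (set_reg st x (reg st y))
| EOp st o x y z :
    exec W (Op o x y z) st 1
         (set_reg st x (eval_op W o (reg st y) (reg st z)))
| EGet st x a y :
    exec W (Get x a y) st 1 (set_reg st x (arr st a (reg st y)))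
| EPut st a y x :
    exec W (Put a y x) st 1 (set_arr st a (reg st y) (reg st x))
| ESeq p q st1 t1 st2 t2 st3 :
    exec W p st1 t1 st2 -> exec W q st2 t2 st3 ->
    exec W (Seq p q) st1 (t1 + t2) st3
| EIfTrue x p q st t st' :
    reg st x <> 0 -> exec W p st t st' ->
    exec W (If x p q) st (1 + t) st'
| EIfFalse x p q st t st' :
    reg st x = 0 -> exec W q st t st' ->
    exec W (If x p q) st (1 + t) st'
| EWhileDone x p st :
    reg st x = 0 -> exec W (While x p) st 1 st
| EWhileStep x p st1 t1 st2 t2 st3 :
    reg st1 x <> 0 -> exec W p st1 t1 st2 ->
    exec W (While x p) st2 t2 st3 ->
    exec W (While x p) st1 (1 + t1 + t2) st3.

(* Input and output are sequences of words, stored at the beginning of array 0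
   with their length in register 0. *)
Definition holds (st : state) (s : list nat) : Prop :=
  reg st 0 = length s /\
  forall i, i < length s -> arr st 0 i = nth i s 0.

Definition is_words (W : nat) (st : state) : Prop :=
  (forall x, reg st x < 2 ^ W) /\ (forall a i, arr st a i < 2 ^ W).

(* [p] maps [input] to [output] within time [T] on every machine whose words
   have at least [c * (1 + log (1 + |input|))] bits.  Registers and memory cells
   not occupied by the input are uninitialized: they hold arbitrary words. *)
Definition computes_within (p : prog) (c : nat)
    (input output : list nat) (T : R) : Prop :=
  forall W st,
    c * (1 + Nat.log2 (1 + length input)) <= W ->
    is_words W st -> holds st input ->
    exists t st', exec W p st t st' /\ holds st' output /\ (INR t <= T)%R.

(** * Boolean matrix multiplication

    An [n] by [n] Boolean matrix is given by its entries [A i j], [i, j < n]. *)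

Definition bool_mul (n : nat) (A B : nat -> nat -> bool) (i j : nat) : bool :=
  existsb (fun k => A i k && B k j) (seq 0 n).

Definition row_major (n : nat) (A : nat -> nat -> bool) : list nat :=
  flat_map (fun i => map (fun j => Nat.b2n (A i j)) (seq 0 n)) (seq 0 n).

(* [n ^ omega]; [Rpower 0 omega] is not 0 in Stdlib. *)
Definition npow (n : nat) (omega : R) : R :=
  if n =? 0 then 0%R else Rpower (INR n) omega.

(* Two [n] by [n] Boolean matrices can be multiplied in O(n ^ omega) time. *)
Definition matmul_exponent (omega : R) : Prop :=
  exists (p : prog) (c : nat) (C : R),
    forall (n : nat) (A B : nat -> nat -> bool),
      0 < n ->
      computes_within p c
        (n :: row_major n A ++ row_major n B)
        (row_major n (bool_mul n A B))
        (C * npow n omega)%R.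

(** * Grammars

    Nonterminals are [0, ..., nvar - 1], in no particular order, and terminals
    are [0, ..., nsig - 1]. *)

Inductive symbol : Set :=
| NT (v : nat)
| Tm (a : nat).

Record cfg : Set := Cfg {
  nvar : nat;
  nsig : nat;
  rules : list (nat * list symbol);
  start : nat
}.

Definition symbol_ok (G : cfg) (x : symbol) : Prop :=
  match x with NT v => v < nvar G | Tm a => a < nsig G end.

Definition is_cfg (G : cfg) : Prop :=
  start G < nvar G /\ NoDup (rules G) /\
  forall v alpha, In (v, alpha) (rules G) ->
    v < nvar G /\ Forall (symbol_ok G) alpha.

Definition step (G : cfg) (x y : list symbol) : Prop :=
  exists l v r alpha,
    In (v, alpha) (rules G) /\ x = l ++ NT v :: r /\ y = l ++ alpha ++ r.

Definition derives (G : cfg) : list symbol -> list symbol -> Prop :=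
  clos_refl_trans _ (step G).

Definition language (G : cfg) (u : list nat) : Prop :=
  derives G [NT (start G)] (map Tm u).

Definition generates (G : cfg) (w : list nat) : Prop :=
  forall u, language G u <-> u = w.

(* A one-string language alone allows several productions for a nonterminal
   (S -> a, S -> B, B -> a), so uniqueness is part of the definition. *)
Definition is_slg (G : cfg) : Prop :=
  is_cfg G /\
  (exists w, generates G w) /\
  (forall v, v < nvar G ->
     exists x, derives G [NT (start G)] x /\ In (NT v) x) /\
  (forall v, v < nvar G -> exists! alpha, In (v, alpha) (rules G)).

Definition rhs (G : cfg) (v : nat) : list symbol :=
  match find (fun r => fst r =? v) (rules G) with
  | Some r => snd r
  | None => []
  end.

Definition is_slp (G : cfg) : Prop :=
  is_slg G /\
  forall v, v < nvar G ->
    (exists a b, a < nvar G /\ b < nvar G /\ rhs G v = [NT a; NT b]) \/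
    (exists a, a < nsig G /\ rhs G v = [Tm a]).

Definition size (G : cfg) : nat :=
  list_sum (map (fun v => length (rhs G v)) (seq 0 (nvar G))).

(** * Word Break *)

Definition is_dictionary (sigma : nat) (D : list (list nat)) : Prop :=
  NoDup D /\ Forall (Forall (fun a => a < sigma)) D.

Definition word_break (w : list nat) (D : list (list nat)) : Prop :=
  exists fs, Forall (fun f => In f D) fs /\ w = concat fs.

Definition total_length (D : list (list nat)) : nat :=
  list_sum (map (@length nat) D).

Definition max_length (D : list (list nat)) : nat :=
  list_max (map (@length nat) D).

Definition encode_symbol (x : symbol) : list nat :=
  match x with NT v => [0; v] | Tm a => [1; a] end.

Definition encode_rule (r : nat * list symbol) : list nat :=
  fst r :: length (snd r) :: flat_map encode_symbol (snd r).

Definition encode_dictionary (D : list (list nat)) : list nat :=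
  length D :: flat_map (fun d => length d :: d) D.

Definition encode_cfg (G : cfg) : list nat :=
  nvar G :: start G :: length (rules G) :: flat_map encode_rule (rules G).

Definition encode_instance (D : list (list nat)) (G : cfg) : list nat :=
  nsig G :: encode_dictionary D ++ encode_cfg G.

(* Main.v *)
Require Import Defs.
From Stdlib Require Import Reals ZArith List Arith Bool Relations Lia Lra Sorted.
From Stdlib Require Import ClassicalEpsilon FunctionalExtensionality.
Import ListNotations.

(** For a string [x], let [B_x] be the Boolean matrix whose entry [(i, j)] tells
    whether [x] without its first [i] and last [j] letters is a concatenation of
    dictionary words, for [i, j < m].  If [i <= |y|] and [j <= |z|], a
    factorization of that part of [yz] either cuts between [y] and [z] or has one
    word straddling this border, so [B_yz] agrees there with [B_y * C * B_z],
    where [C (p, q)] holds if [p = q = 0] or if [p, q > 0] and the last [p]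
    letters of [y] followed by the first [q] letters of [z] form a word.  The
    remaining entries are entries of [B_z] (when [i > |y|]) or of [B_y] (when
    [j > |z|]).  A trie of the dictionary gives [C] in time [O(m^2)] from the
    suffixes and prefixes of length below [m], so every nonterminal costs two
    matrix products and [O(m^2)]; lengths may be cut off at [m].  A depth-first
    search evaluates the children of a nonterminal before it. *)

(** * Structured programs over expressions *)

(** A word straddling a border takes at least one letter from each side, hence at most [m - 1] from
    either; this is why matrices with indices below [m] suffice. Lengths are only compared with such
    indices or used to locate letters among the first [m], which is why they may be cut off at [m].
    Expansions can be exponentially long, so they occur only in the specification; for each
    nonterminal the machine keeps a summary of O(m^2) cells. Memory starts with arbitrary contents,
    so every table, trie row and flag is written before it is read. The multiplication routine is an
    arbitrary program; its registers and arrays are renamed away from those of its caller. It can be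
    called again and again because it is correct from any contents of the memory outside its input.
    Nonterminals are numbered in no useful order. The search terminates because expansions get
    strictly shorter from a nonterminal to its children, so no nonterminal is ever stacked twice at
    the same time. *)

Inductive expr : Set :=
| Num (k : nat)
| Var (x : nat)
| Bin (o : binop) (e f : expr)
| Cell (a : nat) (e : expr)
| Cond (e f g : expr).

(* Program variables are the registers up to 100.  The odd registers above hold
   intermediate values of expressions; the even registers from 100 on, and the
   arrays from 100 on, are left to the matrix multiplication routine. *)
Definition tmp (d : nat) : nat := 101 + 2 * d.

Definition shift_reg (x : nat) : nat := 100 + 2 * x.

Definition shift_arr (a : nat) : nat := 100 + a.

(** The depth [d] is the height of an evaluation stack known at compile time: the result lands in
    [tmp d], and no temporary below it is touched. *)
Fixpoint compile (d : nat) (e : expr) : prog :=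
  match e with
  | Num k => Const (tmp d) k
  | Var x => Move (tmp d) x
  | Bin o e f =>
      Seq (compile d e) (Seq (compile (S d) f) (Op o (tmp d) (tmp d) (tmp (S d))))
  | Cell a e => Seq (compile d e) (Get (tmp d) a (tmp d))
  | Cond e f g => Seq (compile d e) (If (tmp d) (compile d f) (compile d g))
  end.

Fixpoint cost (e : expr) : nat :=
  match e with
  | Num _ | Var _ => 1
  | Bin _ e f => cost e + cost f + 1
  | Cell _ e => cost e + 1
  | Cond e f g => cost e + 1 + cost f + cost g
  end.

(** The ideal counterpart of [eval_op]: no reduction modulo [2 ^ W], and truncated subtraction. The
    two coincide under [bin_fits]. *)
Definition bin_val (o : binop) (x y : nat) : nat :=
  match o with
  | OAdd => x + y
  | OSub => x - y
  | OMul => x * y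
  | ODiv => x / y
  | OMod => x mod y
  | OAnd => Nat.land x y
  | OOr => Nat.lor x y
  | OXor => Nat.lxor x y
  | OShl => Nat.shiftl x y
  | OShr => Nat.shiftr x y
  | OLt => Nat.b2n (x <? y)
  | OEq => Nat.b2n (x =? y)
  end.

Fixpoint val (s : state) (e : expr) : nat :=
  match e with
  | Num k => k
  | Var x => reg s x
  | Bin o e f => bin_val o (val s e) (val s f)
  | Cell a e => arr s a (val s e)
  | Cond e f g => if val s e =? 0 then val s g else val s f
  end.

(* Sufficient for [o] to act on words below [B] without wrapping around;
   the bitwise operations are not used. *)
Definition bin_fits (B : nat) (o : binop) (x y : nat) : Prop :=
  match o with
  | OAdd => x + y < B
  | OSub => y <= x
  | OMul => x * y < B
  | ODiv | OMod | OLt | OEq => True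
  | _ => False
  end.

(** A conditional constrains only the branch taken, so its test can guard a subtraction that would
    otherwise wrap around. *)
Fixpoint fits (B : nat) (s : state) (e : expr) : Prop :=
  match e with
  | Num k => k < B
  | Var x => x <= 100
  | Bin o e f => fits B s e /\ fits B s f /\ bin_fits B o (val s e) (val s f)
  | Cell _ e => fits B s e
  | Cond e f g =>
      fits B s e /\ (val s e <> 0 -> fits B s f) /\ (val s e = 0 -> fits B s g)
  end.

(** Relates a machine state to the model state one reasons about. Registers above 100 are ignored;
    register 100 is kept because it is register 0 of the relocated multiplication routine and
    carries the length of its input. *)
Definition agree (st s : state) : Prop :=
  (forall x, x <= 100 -> reg st x = reg s x) /\
  (forall a i, arr st a i = arr s a i).

Definition realizes (W : nat) (st s : state) : Prop :=
  0 < W /\ is_words W st /\ agree st s.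

Lemma pow2_gt1 (W : nat) : 0 < W -> 1 < 2 ^ W.
Proof. intros H. destruct W; [lia|]. simpl. pose proof (Nat.pow_nonzero 2 W). lia. Qed.

Lemma eval_op_fits (W : nat) (o : binop) (x y : nat) :
  0 < W -> x < 2 ^ W -> y < 2 ^ W -> bin_fits (2 ^ W) o x y ->
  eval_op W o x y = bin_val o x y /\ bin_val o x y < 2 ^ W.
Proof.
  intros HW Hx Hy Hf. pose proof (pow2_gt1 W HW) as H1.
  assert (Hb : forall b, Nat.b2n b < 2 ^ W) by (intros []; simpl; lia).
  destruct o; unfold eval_op; simpl in *; try contradiction.
  - split; [apply Nat.mod_small|]; lia.
  - replace (x + 2 ^ W - y) with ((x - y) + 1 * 2 ^ W) by lia.
    rewrite Nat.Div0.mod_add. split; [apply Nat.mod_small|]; lia.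
  - split; [apply Nat.mod_small|]; lia.
  - assert (x / y <= x) by (destruct y; [simpl; lia | apply Nat.Div0.div_le_upper_bound; nia]).
    split; [apply Nat.mod_small|]; lia.
  - assert (x mod y <= x) by apply Nat.Div0.mod_le.
    split; [apply Nat.mod_small|]; lia.
  - split; [apply Nat.mod_small|]; apply Hb.
  - split; [apply Nat.mod_small|]; apply Hb.
Qed.

Lemma is_words_set_reg (W : nat) (st : state) (x v : nat) :
  is_words W st -> v < 2 ^ W -> is_words W (set_reg st x v).
Proof.
  intros [H1 H2] Hv. split; simpl; [|exact H2].
  intros y. unfold upd. destruct (y =? x); auto.
Qed.

Lemma is_words_set_arr (W : nat) (st : state) (a i v : nat) :
  is_words W st -> v < 2 ^ W -> is_words W (set_arr st a i v).
Proof.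
  intros [H1 H2] Hv. split; simpl; [exact H1|].
  intros b j. unfold upd. destruct (b =? a); auto. destruct (j =? i); auto.
Qed.

Lemma exec_is_words (W : nat) (p : prog) (st : state) (t : nat) (st' : state) :
  exec W p st t st' -> is_words W st -> is_words W st'.
Proof.
  assert (H0 : 2 ^ W <> 0) by (apply Nat.pow_nonzero; lia).
  induction 1; intros Hw; auto.
  - apply is_words_set_reg; auto. now apply Nat.mod_upper_bound.
  - apply is_words_set_reg; auto. apply Hw.
  - apply is_words_set_reg; auto. unfold eval_op. now apply Nat.mod_upper_bound.
  - apply is_words_set_reg; auto. apply Hw.
  - apply is_words_set_arr; auto. apply Hw.
Qed.

Lemma upd_eq {A : Type} (f : nat -> A) (i : nat) (v : A) : upd f i v i = v.
Proof. unfold upd. now rewrite Nat.eqb_refl. Qed.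

Lemma upd_neq {A : Type} (f : nat -> A) (i j : nat) (v : A) :
  j <> i -> upd f i v j = f j.
Proof. intros H. unfold upd. apply Nat.eqb_neq in H. now rewrite H. Qed.

(** The clause on registers below [tmp d] carries the induction: it keeps the left operand alive
    while the right one is computed one level higher. *)
Lemma compile_exec (W : nat) (s : state) (e : expr) :
  fits (2 ^ W) s e -> forall (d : nat) (st : state), realizes W st s ->
  exists t st', exec W (compile d e) st t st' /\ t <= cost e /\
    reg st' (tmp d) = val s e /\ realizes W st' s /\
    forall x, x < tmp d -> reg st' x = reg st x.
Proof.
  assert (Hset : forall st x v, realizes W st s -> 100 < x -> v < 2 ^ W ->
    realizes W (set_reg st x v) s).
  { intros st x v (HW & Hw & Ha & Hb) Hx Hv. split; [exact HW|split].
    - now apply is_words_set_reg.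
    - split; simpl; auto. intros y Hy. rewrite upd_neq by lia. auto. }
  induction e as [k|x|o e IHe f IHf|a e IHe|e IHe f IHf g IHg]; simpl; intros Hfit d st Hst.
  - exists 1, (set_reg st (tmp d) (k mod 2 ^ W)). rewrite Nat.mod_small by auto.
    split. { rewrite <- (Nat.mod_small k (2 ^ W)) at 2 by auto. constructor. }
    split; [lia|]. split; [simpl; now rewrite upd_eq|].
    split; [apply Hset; unfold tmp; auto; lia|].
    intros y Hy. simpl. apply upd_neq. lia.
  - exists 1, (set_reg st (tmp d) (reg st x)).
    split; [constructor|]. split; [lia|].
    split. { simpl. rewrite upd_eq. apply Hst. auto. }
    split; [apply Hset; unfold tmp; auto; [lia|apply Hst]|].
    intros y Hy. simpl. apply upd_neq. lia.
  - destruct Hfit as (Hfe & Hff & Hfo).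
    destruct (IHe Hfe d st Hst) as (t1 & st1 & E1 & T1 & R1 & G1 & P1).
    destruct (IHf Hff (S d) st1 G1) as (t2 & st2 & E2 & T2 & R2 & G2 & P2).
    assert (R3 : reg st2 (tmp d) = val s e)
      by (rewrite P2 by (unfold tmp; lia); exact R1).
    destruct G2 as (HW & Hw2 & Ha2).
    destruct (eval_op_fits W o (val s e) (val s f) HW) as (V1 & V2); auto.
    { rewrite <- R3. apply Hw2. } { rewrite <- R2. apply Hw2. }
    exists (t1 + (t2 + 1)), (set_reg st2 (tmp d) (eval_op W o (reg st2 (tmp d)) (reg st2 (tmp (S d))))).
    split. { econstructor; [exact E1|]. econstructor; [exact E2|]. constructor. }
    rewrite R2, R3, V1. split; [lia|]. split; [simpl; now rewrite upd_eq|].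
    split; [apply Hset; [split; auto | unfold tmp; lia | auto]|].
    intros y Hy. simpl. rewrite upd_neq by lia. rewrite P2 by (unfold tmp in *; lia). auto.
  - destruct (IHe Hfit d st Hst) as (t1 & st1 & E1 & T1 & R1 & G1 & P1).
    exists (t1 + 1), (set_reg st1 (tmp d) (arr st1 a (reg st1 (tmp d)))).
    split. { econstructor; [exact E1|]. constructor. }
    split; [lia|]. split. { simpl. rewrite upd_eq, R1. apply G1. }
    split; [apply Hset; auto; [unfold tmp; lia | apply G1]|].
    intros y Hy. simpl. rewrite upd_neq by lia. auto.
  - destruct Hfit as (Hfe & Hff & Hfg).
    destruct (IHe Hfe d st Hst) as (t1 & st1 & E1 & T1 & R1 & G1 & P1).
    destruct (Nat.eqb_spec (val s e) 0) as [H0|H0].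
    + destruct (IHg (Hfg H0) d st1 G1) as (t2 & st2 & E2 & T2 & R2 & G2 & P2).
      exists (t1 + (1 + t2)), st2. split.
      { econstructor; [exact E1|]. apply EIfFalse; [congruence|exact E2]. }
      split; [lia|]. split; [auto|]. split; [auto|].
      intros y Hy. rewrite P2; auto.
    + destruct (IHf (Hff H0) d st1 G1) as (t2 & st2 & E2 & T2 & R2 & G2 & P2).
      exists (t1 + (1 + t2)), st2. split.
      { econstructor; [exact E1|]. apply EIfTrue; [congruence|exact E2]. }
      split; [lia|]. split; [auto|]. split; [auto|].
      intros y Hy. rewrite P2; auto.
Qed.

(** * Commands and timed total correctness *)

Definition assign (x : nat) (e : expr) : prog :=
  Seq (compile 0 e) (Move x (tmp 0)).

Definition store (a : nat) (e f : expr) : prog :=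
  Seq (compile 0 e) (Seq (compile 1 f) (Put a (tmp 0) (tmp 1))).

Definition cond (e : expr) (p q : prog) : prog :=
  Seq (compile 0 e) (If (tmp 0) p q).

(** [While] tests a register, so the guard is evaluated once before the loop and again at the end of
    each iteration. *)
Definition loop (e : expr) (p : prog) : prog :=
  Seq (compile 0 e) (While (tmp 0) (Seq p (compile 0 e))).

(** A total correctness triple with a time budget. The postcondition may itself be a [runs]
    statement about the rest of the program, which turns repeated use of [runs_seq] into symbolic
    execution. *)
Definition runs (W : nat) (p : prog) (s : state) (n : nat) (Q : state -> Prop) : Prop :=
  forall st, realizes W st s ->
  exists t st' s', exec W p st t st' /\ t <= n /\ realizes W st' s' /\ Q s'.

Lemma runs_weaken (W : nat) (p : prog) (s : state) (n n' : nat) (Q Q' : state -> Prop) :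
  runs W p s n Q -> n <= n' -> (forall s', Q s' -> Q' s') -> runs W p s n' Q'.
Proof.
  intros H Hn HQ st Hst. destruct (H st Hst) as (t & st' & s' & E & T & G & P).
  exists t, st', s'. split; [exact E|]. split; [lia|]. auto.
Qed.

Lemma runs_le (W : nat) (p : prog) (s : state) (n n' : nat) (Q : state -> Prop) :
  runs W p s n Q -> n <= n' -> runs W p s n' Q.
Proof. intros H Hn. eapply runs_weaken; eauto. Qed.

Lemma runs_skip (W : nat) (s : state) (Q : state -> Prop) : Q s -> runs W Skip s 1 Q.
Proof.
  intros H st Hst. exists 1, st, s. split; [constructor|]. split; [lia|]. auto.
Qed.

Lemma runs_seq (W : nat) (p q : prog) (s : state) (n1 n2 : nat) (Q : state -> Prop) :
  runs W p s n1 (fun s' => runs W q s' n2 Q) -> runs W (Seq p q) s (n1 + n2) Q.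
Proof.
  intros H st Hst. destruct (H st Hst) as (t & st' & s' & E & T & G & P).
  destruct (P st' G) as (t2 & st2 & s2 & E2 & T2 & G2 & P2).
  exists (t + t2), st2, s2. split; [econstructor; eauto|]. split; [lia|]. auto.
Qed.

Lemma runs_assign (W : nat) (x : nat) (e : expr) (s : state) (Q : state -> Prop) :
  x <= 100 -> fits (2 ^ W) s e -> Q (set_reg s x (val s e)) ->
  runs W (assign x e) s (cost e + 1) Q.
Proof.
  intros Hx Hf HQ st Hst.
  destruct (compile_exec W s e Hf 0 st Hst) as (t & st' & E & T & R & (HW & Hw & Ha & Hb) & _).
  exists (t + 1), (set_reg st' x (reg st' (tmp 0))), (set_reg s x (val s e)).
  split; [econstructor; [exact E|constructor]|]. split; [lia|]. split; [|exact HQ].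
  split; [exact HW|]. split; [apply is_words_set_reg; auto; apply Hw|].
  split; simpl; auto. intros y Hy. unfold upd. destruct (y =? x); auto.
Qed.

Lemma runs_store (W : nat) (a : nat) (e f : expr) (s : state) (Q : state -> Prop) :
  fits (2 ^ W) s e -> fits (2 ^ W) s f -> Q (set_arr s a (val s e) (val s f)) ->
  runs W (store a e f) s (cost e + cost f + 1) Q.
Proof.
  intros He Hf HQ st Hst.
  destruct (compile_exec W s e He 0 st Hst) as (t & st1 & E & T & R & G & _).
  destruct (compile_exec W s f Hf 1 st1 G) as (t2 & st2 & E2 & T2 & R2 & (HW & Hw & Ha & Hb) & P2).
  exists (t + (t2 + 1)), (set_arr st2 a (reg st2 (tmp 0)) (reg st2 (tmp 1))),
    (set_arr s a (val s e) (val s f)).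
  split; [econstructor; [exact E|]; econstructor; [exact E2|constructor]|].
  split; [lia|]. split; [|exact HQ]. split; [exact HW|].
  split; [apply is_words_set_arr; auto; apply Hw|].
  split; simpl; auto. intros b i. unfold upd. rewrite P2 by (unfold tmp; lia). rewrite R, R2.
  destruct (b =? a); auto. destruct (i =? val s e); auto.
Qed.

Lemma runs_cond (W : nat) (e : expr) (p q : prog) (s : state) (n : nat) (Q : state -> Prop) :
  fits (2 ^ W) s e ->
  (val s e <> 0 -> runs W p s n Q) -> (val s e = 0 -> runs W q s n Q) ->
  runs W (cond e p q) s (cost e + 1 + n) Q.
Proof.
  intros He Hp Hq st Hst.
  destruct (compile_exec W s e He 0 st Hst) as (t & st1 & E & T & R & G & _).
  destruct (Nat.eq_dec (val s e) 0) as [H0|H0].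
  - destruct (Hq H0 st1 G) as (t2 & st2 & s2 & E2 & T2 & G2 & P2).
    exists (t + (1 + t2)), st2, s2. split; [|split; [lia|auto]].
    econstructor; [exact E|]. apply EIfFalse; [congruence|auto].
  - destruct (Hp H0 st1 G) as (t2 & st2 & s2 & E2 & T2 & G2 & P2).
    exists (t + (1 + t2)), st2, s2. split; [|split; [lia|auto]].
    econstructor; [exact E|]. apply EIfTrue; [congruence|auto].
Qed.

(* The invariant [I k] is indexed by a time budget [k] for the remaining
   iterations. *)
Lemma runs_loop (W : nat) (e : expr) (p : prog) (I : nat -> state -> Prop) (Q : state -> Prop) :
  (forall k s, I k s -> fits (2 ^ W) s e /\
     (val s e = 0 -> Q s) /\
     (val s e <> 0 -> exists n k', n + k' + cost e + 1 <= k /\ runs W p s n (I k'))) ->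
  forall k s, I k s -> runs W (loop e p) s (cost e + 1 + k) Q.
Proof.
  intros HI k s Hs st Hst.
  destruct (HI k s Hs) as (He & _).
  destruct (compile_exec W s e He 0 st Hst) as (t & st1 & E & T & R & G & _).
  cut (exists t2 st2 s2, exec W (While (tmp 0) (Seq p (compile 0 e))) st1 t2 st2 /\
         t2 <= 1 + k /\ realizes W st2 s2 /\ Q s2).
  { intros (t2 & st2 & s2 & E2 & T2 & G2 & P2). exists (t + t2), st2, s2.
    split; [econstructor; eauto|]. split; [lia|auto]. }
  clear E T Hst st t He. revert s st1 Hs R G.
  induction k as [k IH] using lt_wf_ind. intros s st Hs R G.
  destruct (HI k s Hs) as (_ & H0 & H1).
  destruct (Nat.eq_dec (val s e) 0) as [H|H].
  - exists 1, st, s. split; [apply EWhileDone; congruence|]. split; [lia|auto].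
  - destruct (H1 H) as (n & k' & Hk & Hr).
    destruct (Hr st G) as (t2 & st2 & s2 & E2 & T2 & G2 & P2).
    destruct (HI k' s2 P2) as (He2 & _).
    destruct (compile_exec W s2 e He2 0 st2 G2) as (t3 & st3 & E3 & T3 & R3 & G3 & _).
    destruct (IH k' ltac:(lia) s2 st3 P2 R3 G3) as (t4 & st4 & s4 & E4 & T4 & G4 & P4).
    exists (1 + (t2 + t3) + t4), st4, s4.
    split; [eapply EWhileStep; [congruence | econstructor; eauto | eauto]|].
    split; [lia|auto].
Qed.

(** * Overwriting a block of consecutive cells *)

Definition block (f : nat -> nat) (off n : nat) (g : nat -> nat) (i : nat) : nat :=
  if (off <=? i) && (i <? off + n) then g (i - off) else f i.

Definition set_block (s : state) (a off n : nat) (g : nat -> nat) : state :=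
  State (reg s) (upd (arr s) a (block (arr s a) off n g)).

Lemma block_in (f : nat -> nat) (off n : nat) (g : nat -> nat) (k : nat) :
  k < n -> block f off n g (off + k) = g k.
Proof.
  intros H. unfold block.
  rewrite (proj2 (Nat.leb_le _ _)), (proj2 (Nat.ltb_lt _ _)) by lia.
  simpl. f_equal. lia.
Qed.

Lemma block_out (f : nat -> nat) (off n : nat) (g : nat -> nat) (i : nat) :
  i < off \/ off + n <= i -> block f off n g i = f i.
Proof.
  intros H. unfold block.
  destruct (Nat.leb_spec off i), (Nat.ltb_spec i (off + n)); simpl; auto; lia.
Qed.

Lemma realizes_ext (W : nat) (st s s' : state) :
  realizes W st s -> agree s s' -> realizes W st s'.
Proof.
  intros (HW & Hw & Ha & Hb) (Hc & Hd). split; [exact HW|split; [exact Hw|]].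
  split; intros; rewrite <- ?Hc, <- ?Hd; auto.
Qed.

Lemma runs_ext (W : nat) (p : prog) (s s' : state) (n : nat) (Q : state -> Prop) :
  agree s s' -> runs W p s' n Q -> runs W p s n Q.
Proof. intros Ha H st Hst. apply H. eapply realizes_ext; eauto. Qed.

(* Register 99 counts the cells written; [e] may refer to it. *)
Definition fill (a ro rn : nat) (e : expr) : prog :=
  Seq (assign 99 (Num 0))
      (loop (Bin OLt (Var 99) (Var rn))
            (Seq (store a (Bin OAdd (Var ro) (Var 99)) e)
                 (assign 99 (Bin OAdd (Var 99) (Num 1))))).

(** The final model state is chosen existentially, so [Q] need only hold at one representative. This
    allows a closed form such as [set_block] to replace a pointwise equal chain of updates. *)
Lemma runs_agree (W : nat) (p : prog) (s s1 : state) (n : nat) (Q : state -> Prop) :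
  runs W p s n (fun s' => agree s' s1) -> Q s1 -> runs W p s n Q.
Proof.
  intros H HQ st Hst. destruct (H st Hst) as (t & st' & s' & E & T & G & P).
  exists t, st', s1. split; [exact E|]. split; [exact T|]. split; [|exact HQ].
  eapply realizes_ext; eauto.
Qed.

(** The expression is evaluated in the state where the first [k] cells are already written, so it
    may refer to earlier cells of the same table; dynamic programming is a single [fill]. *)
Lemma runs_fill (W : nat) (a ro rn : nat) (e : expr) (off n : nat) (g : nat -> nat)
    (s : state) (Q : state -> Prop) :
  ro < 99 -> rn < 99 -> reg s ro = off -> reg s rn = n -> off + n < 2 ^ W ->
  (forall k, k < n -> let s' := set_reg (set_block s a off k g) 99 k in
     fits (2 ^ W) s' e /\ val s' e = g k) ->
  Q (set_reg (set_block s a off n g) 99 n) ->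
  runs W (fill a ro rn e) s (7 + n * (cost e + 13)) Q.
Proof.
  intros Hro Hrn Eoff En Hoff He HQ.
  set (S k := set_reg (set_block s a off k g) 99 k) in *.
  destruct (Nat.eq_dec W 0) as [->|HW].
  { intros st (HW & _). lia. }
  assert (H1 : 1 < 2 ^ W) by (apply pow2_gt1; lia).
  assert (R99 : forall k, reg (S k) 99 = k) by reflexivity.
  assert (Ro : forall k, reg (S k) ro = off)
    by (intros k; simpl; rewrite upd_neq by lia; auto).
  assert (Rn : forall k, reg (S k) rn = n)
    by (intros k; simpl; rewrite upd_neq by lia; auto).
  eapply runs_agree; [|exact HQ]. eapply runs_le.
  { unfold fill. eapply runs_seq. apply runs_assign; [lia|simpl; lia|].
    apply (runs_loop W _ _ (fun t s' => exists k, k <= n /\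
             t = (n - k) * (cost e + 13) /\ agree s' (S k))).
    2:{ exists 0. split; [lia|]. split; [reflexivity|].
        split; [reflexivity|]. simpl. intros b i. unfold upd.
        destruct (Nat.eqb_spec b a); auto.
        subst. rewrite block_out; auto. lia. }
    intros t s' (k & Hk & -> & Ha). simpl.
    rewrite (proj1 Ha 99), (proj1 Ha rn), R99, Rn by lia.
    split; [lia|].
    destruct (Nat.ltb_spec k n) as [Hkn|Hkn]; simpl; (split; intros ?); try lia.
    2:{ replace n with k by lia. exact Ha. }
    exists (1 + 1 + 1 + cost e + 1 + (1 + 1 + 1 + 1)), ((n - (k + 1)) * (cost e + 13)).
    split. { replace (n - k) with (Datatypes.S (n - (k + 1))) by lia. simpl. lia. }
    eapply runs_ext; [exact Ha|].
    destruct (He k Hkn) as (Hf & Hv). simpl in Hf, Hv. fold (S k) in Hf, Hv.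
    apply (runs_seq W _ _ _ (1 + 1 + 1 + cost e + 1) (1 + 1 + 1 + 1)).
    apply (runs_store W a (Bin OAdd (Var ro) (Var 99)) e).
    { cbn [fits bin_fits val]. rewrite Ro, R99. lia. }
    { exact Hf. }
    cbn [val bin_val]. rewrite Ro, R99, Hv.
    apply (runs_assign W 99 (Bin OAdd (Var 99) (Num 1))); [lia| |].
    { cbn [fits bin_fits val]. cbn [set_arr reg]. rewrite R99. lia. }
    exists (k + 1). split; [lia|]. split; [reflexivity|].
    split.
    - intros x Hx. cbn [val bin_val set_arr set_reg reg]. rewrite R99. simpl. unfold upd.
      destruct (x =? 99); reflexivity.
    - intros b i. simpl. destruct (Nat.eq_dec b a) as [->|Hb].
      2:{ rewrite !upd_neq; auto. }
      rewrite !upd_eq. unfold upd. destruct (Nat.eqb_spec i (off + k)) as [->|Hi].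
      + symmetry. apply block_in. lia.
      + unfold block.
        destruct (Nat.leb_spec off i), (Nat.ltb_spec i (off + k)), (Nat.ltb_spec i (off + (k + 1)));
          simpl; auto; try lia. }
  simpl. lia.
Qed.

(** * Relocating a subroutine *)

Fixpoint relocate (p : prog) : prog :=
  match p with
  | Skip => Skip
  | Const x k => Const (shift_reg x) k
  | Move x y => Move (shift_reg x) (shift_reg y)
  | Op o x y z => Op o (shift_reg x) (shift_reg y) (shift_reg z)
  | Get x a y => Get (shift_reg x) (shift_arr a) (shift_reg y)
  | Put a y x => Put (shift_arr a) (shift_reg y) (shift_reg x)
  | Seq p q => Seq (relocate p) (relocate q)
  | If x p q => If (shift_reg x) (relocate p) (relocate q)
  | While x p => While (shift_reg x) (relocate p)
  end.

Definition relocated (st st2 : state) : Prop :=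
  (forall x, reg st2 (shift_reg x) = reg st x) /\
  (forall a i, arr st2 (shift_arr a) i = arr st a i).

Lemma relocated_set_reg (st st2 : state) (x v : nat) :
  relocated st st2 -> relocated (set_reg st x v) (set_reg st2 (shift_reg x) v).
Proof.
  intros [H1 H2]. split; simpl; [|exact H2]. intros y. unfold upd.
  destruct (Nat.eqb_spec y x), (Nat.eqb_spec (shift_reg y) (shift_reg x));
    unfold shift_reg in *; auto; lia.
Qed.

Lemma relocated_set_arr (st st2 : state) (a i v : nat) :
  relocated st st2 -> relocated (set_arr st a i v) (set_arr st2 (shift_arr a) i v).
Proof.
  intros [H1 H2]. split; simpl; [exact H1|]. intros b j. unfold upd.
  destruct (Nat.eqb_spec b a), (Nat.eqb_spec (shift_arr b) (shift_arr a));
    unfold shift_arr in *; auto; try lia. subst.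
  destruct (j =? i); auto.
Qed.

(** Both runs proceed in lockstep, because the renaming is injective and updates commute with it.
    The relocated code addresses only registers and arrays from 100 on. *)
Lemma exec_relocate (W : nat) (p : prog) (st : state) (t : nat) (st' : state) :
  exec W p st t st' -> forall st2, relocated st st2 ->
  exists st2', exec W (relocate p) st2 t st2' /\ relocated st' st2' /\
    (forall x, x < 100 -> reg st2' x = reg st2 x) /\
    (forall a i, a < 100 -> arr st2' a i = arr st2 a i).
Proof.
  assert (Hr : forall st2 y v x, x < 100 -> reg (set_reg st2 (shift_reg y) v) x = reg st2 x).
  { intros. simpl. apply upd_neq. unfold shift_reg. lia. }
  assert (Ha : forall st2 b i v a j, a < 100 -> arr (set_arr st2 (shift_arr b) i v) a j = arr st2 a j).
  { intros. simpl. rewrite upd_neq; auto. unfold shift_arr. lia. }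
  induction 1; intros r2 Hrel; simpl.
  - exists r2. split; [constructor|auto].
  - eexists. split; [constructor|]. split; [now apply relocated_set_reg|auto].
  - eexists. split; [constructor|]. rewrite (proj1 Hrel).
    split; [now apply relocated_set_reg|auto].
  - eexists. split; [constructor|]. rewrite !(proj1 Hrel).
    split; [now apply relocated_set_reg|auto].
  - eexists. split; [constructor|]. rewrite (proj1 Hrel), (proj2 Hrel).
    split; [now apply relocated_set_reg|auto].
  - eexists. split; [constructor|]. rewrite !(proj1 Hrel).
    split; [now apply relocated_set_arr|auto].
  - destruct (IHexec1 r2 Hrel) as (r3 & E1 & R1 & F1 & G1).
    destruct (IHexec2 r3 R1) as (r4 & E2 & R2 & F2 & G2).
    exists r4. split; [econstructor; eauto|]. split; [auto|].
    split; intros; rewrite ?F2, ?G2; auto.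
  - destruct (IHexec r2 Hrel) as (r3 & E1 & R1 & F1 & G1).
    exists r3. split; [apply EIfTrue; [rewrite (proj1 Hrel)|]; auto|auto].
  - destruct (IHexec r2 Hrel) as (r3 & E1 & R1 & F1 & G1).
    exists r3. split; [apply EIfFalse; [rewrite (proj1 Hrel)|]; auto|auto].
  - exists r2. split; [apply EWhileDone; rewrite (proj1 Hrel); auto|auto].
  - destruct (IHexec1 r2 Hrel) as (r3 & E1 & R1 & F1 & G1).
    destruct (IHexec2 r3 R1) as (r4 & E2 & R2 & F2 & G2).
    exists r4. split; [eapply EWhileStep; eauto; rewrite (proj1 Hrel); auto|]. split; [auto|].
    split; intros; rewrite ?F2, ?G2; auto.
Qed.

(** The postcondition quantifies over [r] and [f] because the routine may leave anything in its own
    memory beside the output. *)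
Lemma runs_relocate (p : prog) (c : nat) (input output : list nat) (T : R)
    (W n : nat) (s : state) (Q : state -> Prop) :
  computes_within p c input output T ->
  (forall t, (INR t <= T)%R -> t <= n) ->
  c * (1 + Nat.log2 (1 + length input)) <= W ->
  reg s 100 = length input ->
  (forall i, i < length input -> arr s 100 i = nth i input 0) ->
  (forall r f, (forall i, i < length output -> f 100 i = nth i output 0) ->
     Q (State (upd (reg s) 100 r) (fun a => if a <? 100 then arr s a else f a))) ->
  runs W (relocate p) s n Q.
Proof.
  intros Hp Hn HW Hlen Hin HQ st (W0 & Hw & Hr & Ha).
  (* The machine as the routine sees it. Leftovers of earlier computations are admissible, since
     [computes_within] lets memory outside the input be arbitrary. *)
  set (st0 := State (fun x => reg st (shift_reg x)) (fun a => arr st (shift_arr a))).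
  destruct (Hp W st0 HW) as (t & st1 & E & [HO1 HO2] & HT).
  { split; intros; simpl; apply Hw. }
  { split; simpl.
    - change (reg st 100 = length input). rewrite Hr by lia. exact Hlen.
    - intros i Hi. change (arr st 100 i = nth i input 0). rewrite Ha. auto. }
  destruct (exec_relocate W p st0 t st1 E st) as (st2 & E2 & [R1 R2] & F & G).
  { split; reflexivity. }
  exists t, st2,
    (State (upd (reg s) 100 (reg st2 100)) (fun a => if a <? 100 then arr s a else arr st2 a)).
  split; [exact E2|]. split; [auto|]. split.
  - split; [exact W0|]. split; [eapply exec_is_words; eauto|].
    split; simpl.
    + intros x Hx. destruct (Nat.eq_dec x 100) as [->|Hx'].
      * now rewrite upd_eq.
      * rewrite upd_neq, F by lia. apply Hr. lia.
    + intros a i. destruct (Nat.ltb_spec a 100); auto. rewrite G; auto.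
  - apply HQ. intros i Hi. change 100 with (shift_arr 0). rewrite R2. auto.
Qed.

(** * Row-major layout of matrices *)

Lemma nth_flat_map_uniform {A : Type} (n : nat) (f : A -> list nat) (l : list A) (a0 : A) (i j : nat) :
  (forall a, length (f a) = n) -> i < length l -> j < n ->
  nth (i * n + j) (flat_map f l) 0 = nth j (f (nth i l a0)) 0.
Proof.
  intros Hf. revert i. induction l as [|a l IH]; simpl; intros i Hi Hj; [lia|].
  destruct i as [|i].
  - simpl. rewrite app_nth1; [auto|]. rewrite Hf. auto.
  - rewrite app_nth2; rewrite Hf; [|nia].
    replace (S i * n + j - n) with (i * n + j) by nia. apply IH; lia.
Qed.

Lemma length_flat_map_uniform {A : Type} (n : nat) (f : A -> list nat) (l : list A) :
  (forall a, length (f a) = n) -> length (flat_map f l) = length l * n.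
Proof.
  intros Hf. induction l; simpl; auto. rewrite length_app, Hf. lia.
Qed.

Lemma length_row_major (n : nat) (A : nat -> nat -> bool) :
  length (row_major n A) = n * n.
Proof.
  unfold row_major. rewrite (length_flat_map_uniform n), length_seq; auto.
  intros. now rewrite length_map, length_seq.
Qed.

Lemma nth_row_major (n t : nat) (A : nat -> nat -> bool) :
  t < n * n -> nth t (row_major n A) 0 = Nat.b2n (A (t / n) (t mod n)).
Proof.
  intros Ht. assert (Hn : n <> 0) by nia.
  rewrite (Nat.div_mod t n Hn) at 1. rewrite (Nat.mul_comm n).
  assert (t / n < n) by (apply Nat.Div0.div_lt_upper_bound; nia).
  assert (t mod n < n) by (now apply Nat.mod_upper_bound).
  unfold row_major. rewrite (nth_flat_map_uniform n) with (a0 := 0); auto.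
  - rewrite seq_nth by auto. rewrite (nth_indep _ 0 (Nat.b2n (A (0 + t / n) 0)))
      by (now rewrite length_map, length_seq).
    rewrite (map_nth (fun j => Nat.b2n (A (0 + t / n) j))), seq_nth by auto. reflexivity.
  - intros. now rewrite length_map, length_seq.
  - now rewrite length_seq.
Qed.

(** * Word Break for concatenations *)

(** A classical truth value, used to specify memory contents and never inside a program. *)
Definition asb (P : Prop) : bool := if excluded_middle_informative P then true else false.

Lemma asb_true (P : Prop) : asb P = true <-> P.
Proof. unfold asb. destruct (excluded_middle_informative P); split; auto; discriminate. Qed.

Lemma asb_false (P : Prop) : asb P = false <-> ~ P.
Proof.
  unfold asb. destruct (excluded_middle_informative P); split; auto; try discriminate; tauto.
Qed.

Lemma asb_iff (P Q : Prop) : (P <-> Q) -> asb P = asb Q.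
Proof.
  intros H. unfold asb.
  destruct (excluded_middle_informative P), (excluded_middle_informative Q); tauto.
Qed.

(** The entries of [B_x]. Asking for an actual split makes an entry false when [i + j] exceeds the
    length of [x], and true when it equals the length, the middle part being empty. *)
Definition inner_break (D : list (list nat)) (x : list nat) (i j : nat) : Prop :=
  exists a b c, x = a ++ b ++ c /\ length a = i /\ length c = j /\ word_break b D.

Definition bridge (D : list (list nat)) (y z : list nat) (p q : nat) : Prop :=
  (p = 0 /\ q = 0) \/
  (0 < p /\ 0 < q /\ exists y' s t z',
     y = y' ++ s /\ z = t ++ z' /\ length s = p /\ length t = q /\ In (s ++ t) D).

Lemma word_break_nil (D : list (list nat)) : word_break [] D.
Proof. exists []. split; auto. Qed.

Lemma word_break_single (D : list (list nat)) (d : list nat) : In d D -> word_break d D.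
Proof. intros H. exists [d]. split; [auto|simpl; now rewrite app_nil_r]. Qed.

Lemma word_break_app (D : list (list nat)) (u v : list nat) :
  word_break u D -> word_break v D -> word_break (u ++ v) D.
Proof.
  intros (fs & H1 & ->) (gs & H2 & ->). exists (fs ++ gs).
  split; [now apply Forall_app|now rewrite concat_app].
Qed.

(** Follow the factors until one is not contained in what remains of [u], or ends exactly with it.
    If it ends at the border, or nothing of [u] remains, the border is a cut; otherwise this factor
    is the straddling word. *)
Lemma word_break_app_inv (D : list (list nat)) (u v : list nat) :
  word_break (u ++ v) D ->
  exists u' s t v', u = u' ++ s /\ v = t ++ v' /\ word_break u' D /\ word_break v' D /\
    ((s = [] /\ t = []) \/ (s <> [] /\ t <> [] /\ In (s ++ t) D)).
Proof.
  intros (fs & Hfs & E). revert u E. induction Hfs as [|f fs Hf Hfs IH]; simpl; intros u E.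
  - apply app_eq_nil in E as [-> ->]. exists [], [], [], []. repeat (split; auto using word_break_nil).
  - apply app_eq_app in E as (l & [(Hu & Hl) | (Hf' & Hv)]).
    + destruct (IH l (eq_sym Hl)) as (u' & s & t & v' & -> & -> & Hu' & Hv' & Hst).
      exists (f ++ u'), s, t, v'. rewrite <- app_assoc. split; [auto|]. split; [auto|].
      split; [|auto]. apply word_break_app; auto. now apply word_break_single.
    + assert (Hfs' : word_break (concat fs) D) by (exists fs; auto).
      destruct l as [|x l].
      { rewrite app_nil_r in Hf'. subst. exists u, [], [], (concat fs).
        rewrite app_nil_r. repeat (split; auto). now apply word_break_single. }
      destruct u as [|y u].
      { exists [], [], [], v. repeat (split; auto using word_break_nil).
        subst v. apply word_break_app; auto. simpl in Hf'. subst f. now apply word_break_single. }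
      exists [], (y :: u), (x :: l), (concat fs). subst.
      repeat (split; auto using word_break_nil). right. repeat split; auto; discriminate.
Qed.

Lemma word_break_singleton (D : list (list nat)) (a : nat) :
  word_break [a] D <-> In [a] D.
Proof.
  split; [|apply word_break_single]. intros (fs & Hfs & E).
  induction Hfs as [|f fs Hf _ IH]; simpl in E; [discriminate|].
  destruct f as [|b f]; [auto|]. simpl in E. injection E as -> E.
  symmetry in E. apply app_eq_nil in E as [-> _]. exact Hf.
Qed.

Lemma inner_break_single (D : list (list nat)) (a i j : nat) :
  inner_break D [a] i j <-> (i + j = 1 \/ (i = 0 /\ j = 0 /\ In [a] D)).
Proof.
  split.
  - intros (u & b & c & E & <- & <- & Hb). destruct u as [|x u]; simpl in *.
    + destruct b as [|y b]; simpl in *; [subst; auto|].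
      injection E as -> E. symmetry in E. apply app_eq_nil in E as [-> ->].
      right. repeat split; auto. now apply word_break_singleton.
    + injection E as -> E. symmetry in E. apply app_eq_nil in E as [-> E].
      apply app_eq_nil in E as [-> ->]. auto.
  - intros [H | (-> & -> & H)].
    + destruct i as [|i].
      * exists [], [], [a]. simpl. repeat split; auto; try lia. apply word_break_nil.
      * exists [a], [], []. simpl. repeat split; auto; try lia. apply word_break_nil.
    + exists [], [a], []. repeat split; auto. now apply word_break_single.
Qed.

(** The bounds [p < m] and [q < m] hold because a straddling word has at most [m] letters and at
    least one on each side; for a cut at the border [p = q = 0], and [0 < m]. *)
Lemma inner_break_app (D : list (list nat)) (m : nat) (y z : list nat) (i j : nat) :
  0 < m -> Forall (fun d => length d <= m) D -> i <= length y -> j <= length z ->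
  inner_break D (y ++ z) i j <->
  exists p q, p < m /\ q < m /\
    inner_break D y i p /\ bridge D y z p q /\ inner_break D z q j.
Proof.
  intros Hm HD Hi Hj. split.
  - intros (a & b & c & E & Ha & Hc & Hb).
    (* The bounds on [i] and [j] keep the border between [y] and [z] inside the middle part [b],
       possibly at one of its ends. *)
    assert (exists b1 b2, b = b1 ++ b2 /\ y = a ++ b1 /\ z = b2 ++ c) as (b1 & b2 & -> & -> & ->).
    { apply app_eq_app in E as (l & [(-> & E) | (-> & ->)]).
      - symmetry in E. apply app_eq_app in E as (l' & [(Hl & Hc') | (-> & ->)]).
        + assert (l' = []) as ->.
          { apply (f_equal (@length nat)) in Hc'. rewrite length_app in Hc'.
            destruct l'; auto. simpl in Hc'. lia. }
          exists b, []. rewrite app_nil_r in *. simpl in Hc'. subst. auto.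
        + exists l, l'. auto.
      - assert (l = []) as ->.
        { rewrite length_app in Ha. destruct l; auto. simpl in Ha. lia. }
        exists [], b. rewrite !app_nil_r. auto. }
    destruct (word_break_app_inv D b1 b2 Hb) as (u & s & t & v & -> & -> & Hu & Hv & Hst).
    exists (length s), (length t).
    assert (Hb' : length s < m /\ length t < m /\
      bridge D (a ++ u ++ s) ((t ++ v) ++ c) (length s) (length t)).
    { destruct Hst as [(-> & ->) | (Hs & Ht & Hst)]; simpl.
      - repeat split; auto. left. auto.
      - rewrite Forall_forall in HD. apply HD in Hst as Hl. rewrite length_app in Hl.
        assert (0 < length s) by (destruct s; simpl; [congruence|lia]).
        assert (0 < length t) by (destruct t; simpl; [congruence|lia]).
        repeat split; try lia. right. repeat split; auto.
        exists (a ++ u), s, t, (v ++ c). rewrite <- !app_assoc. auto. }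
    destruct Hb' as (Hs & Ht & Hbr). repeat split; auto.
    + exists a, u, s. auto.
    + exists t, v, c. rewrite <- app_assoc. auto.
  - intros (p & q & _ & _ & (a & u & s & -> & Ha & Hp & Hu) & Hbr & (t & v & c & -> & Hq & Hc & Hv)).
    exists a, (u ++ s ++ t ++ v), c. rewrite <- !app_assoc. repeat split; auto.
    apply word_break_app; auto. rewrite app_assoc. apply word_break_app; auto.
    destruct Hbr as [(-> & ->) | (_ & _ & y' & s' & t' & z' & E1 & E2 & L1 & L2 & HI)].
    + apply length_zero_iff_nil in Hp, Hq. subst. apply word_break_nil.
    + rewrite app_assoc in E1.
      assert (s = s' /\ t = t') as (-> & ->); [|now apply word_break_single].
      split.
      (* Two suffixes of one string with the same length [p] coincide: compare the first [p] letters
         of the reversals. *)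
      * assert (H := f_equal (fun l => firstn p (rev l)) E1). simpl in H.
        rewrite !rev_app_distr in H.
        rewrite !firstn_app, !length_rev, Hp, L1, Nat.sub_diag in H. simpl in H.
        rewrite !app_nil_r, !firstn_all2 in H by (rewrite length_rev; lia).
        apply (f_equal (@rev nat)) in H. now rewrite !rev_involutive in H.
      * assert (H := f_equal (firstn q) E2).
        rewrite !firstn_app, Hq, L2, Nat.sub_diag in H. simpl in H.
        now rewrite !app_nil_r, !firstn_all2 in H by lia.
Qed.

Lemma inner_break_app_right (D : list (list nat)) (y z : list nat) (i j : nat) :
  length y < i -> inner_break D (y ++ z) i j <-> inner_break D z (i - length y) j.
Proof.
  intros Hi. split.
  - intros (a & b & c & E & Ha & Hc & Hb).
    apply app_eq_app in E as (l & [(-> & E) | (-> & ->)]).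
    + rewrite length_app in Hi. lia.
    + rewrite length_app in Ha. exists l, b, c. repeat split; auto. lia.
  - intros (a & b & c & -> & Ha & Hc & Hb). exists (y ++ a), b, c.
    rewrite <- app_assoc, length_app. repeat split; auto. lia.
Qed.

Lemma inner_break_app_left (D : list (list nat)) (y z : list nat) (i j : nat) :
  length z < j -> inner_break D (y ++ z) i j <-> inner_break D y i (j - length z).
Proof.
  intros Hj. split.
  - intros (a & b & c & E & Ha & Hc & Hb). rewrite app_assoc in E.
    apply app_eq_app in E as (l & [(-> & ->) | (E & ->)]).
    + exists a, b, l. rewrite <- app_assoc. rewrite length_app in Hc. repeat split; auto. lia.
    + rewrite length_app in Hj. lia.
  - intros (a & b & c & -> & Ha & Hc & Hb). exists a, b, (c ++ z).
    rewrite <- !app_assoc, length_app. repeat split; auto. lia.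
Qed.

Lemma inner_break_zero (D : list (list nat)) (x : list nat) :
  inner_break D x 0 0 <-> word_break x D.
Proof.
  split.
  - intros (a & b & c & -> & Ha & Hc & Hb). apply length_zero_iff_nil in Ha, Hc. subst.
    simpl. now rewrite app_nil_r.
  - intros H. exists [], x, []. rewrite app_nil_r. auto.
Qed.

(** * Expansions of nonterminals *)

(** Being inductive, this relation gives nothing to a nonterminal that leads back to itself; that
    every nonterminal of an SLP has an expansion must be derived from the language being
    nonempty. *)
Inductive expands (G : cfg) : nat -> list nat -> Prop :=
| expands_leaf v a : rhs G v = [Tm a] -> expands G v [a]
| expands_pair v a b y z :
    rhs G v = [NT a; NT b] -> expands G a y -> expands G b z -> expands G v (y ++ z).

Lemma expands_length (G : cfg) (v : nat) (x : list nat) : expands G v x -> 0 < length x.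
Proof. induction 1; simpl; [lia|]. rewrite length_app. lia. Qed.

Lemma expands_functional (G : cfg) (v : nat) (x y : list nat) :
  expands G v x -> expands G v y -> x = y.
Proof.
  intros H. revert y. induction H as [v a E|v a b y z E _ IHy _ IHz]; intros x' H'.
  - destruct H' as [? ? E'|? ? ? ? ? E']; congruence.
  - destruct H' as [? ? E'|? ? ? ? ? E' H1 H2]; [congruence|].
    rewrite E in E'. injection E' as <- <-. now rewrite (IHy _ H1), (IHz _ H2).
Qed.

Lemma slp_rule_rhs (G : cfg) (v : nat) (alpha : list symbol) :
  is_slp G -> In (v, alpha) (rules G) -> v < nvar G /\ alpha = rhs G v.
Proof.
  intros [[(_ & _ & Hr) (_ & _ & Hu)] _] Hin.
  destruct (Hr v alpha Hin) as [Hv _]. split; [auto|].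
  destruct (Hu v Hv) as (beta & _ & Hb). unfold rhs.
  destruct (find (fun r => fst r =? v) (rules G)) as [[v' gamma]|] eqn:E.
  - apply find_some in E as [E1 E2]. simpl in *. apply Nat.eqb_eq in E2. subst v'.
    rewrite <- (Hb _ Hin). now apply Hb.
  - eapply find_none in E; [|exact Hin]. simpl in E. now rewrite Nat.eqb_refl in E.
Qed.

Lemma slp_rhs_in (G : cfg) (v : nat) :
  is_slp G -> v < nvar G -> In (v, rhs G v) (rules G).
Proof.
  intros HG Hv. destruct HG as [[H1 (H2 & H3 & Hu)] H4] eqn:E.
  destruct (Hu v Hv) as (beta & Hb & _). destruct (slp_rule_rhs G v beta HG Hb) as [_ <-]. auto.
Qed.

Lemma derives_app (G : cfg) (x x' y y' : list symbol) :
  derives G x x' -> derives G y y' -> derives G (x ++ y) (x' ++ y').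
Proof.
  assert (Hl : forall l r x x', derives G x x' -> derives G (l ++ x ++ r) (l ++ x' ++ r)).
  { intros l r u u' H. induction H as [u u' (l1 & v & r1 & alpha & H & -> & ->)|u|u u1 u2 _ IH1 _ IH2].
    - apply rt_step. exists (l ++ l1), v, (r1 ++ r), alpha. split; [auto|].
      rewrite <- !app_assoc. auto.
    - apply rt_refl.
    - eapply rt_trans; eauto. }
  intros Hx Hy. apply rt_trans with (x' ++ y).
  - apply (Hl [] y _ _ Hx).
  - specialize (Hl x' [] _ _ Hy). now rewrite !app_nil_r in Hl.
Qed.

Lemma expands_derives (G : cfg) (v : nat) (x : list nat) :
  is_slp G -> expands G v x -> v < nvar G -> derives G [NT v] (map Tm x).
Proof.
  intros HG H. induction H as [v a E|v a b y z E _ IHy _ IHz]; intros Hv.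
  - apply rt_step. exists [], v, [], [Tm a]. rewrite <- E. split; [|simpl; now rewrite app_nil_r].
    now apply slp_rhs_in.
  - assert (a < nvar G /\ b < nvar G) as [Ha Hb].
    { destruct HG as [_ Hf]. destruct (Hf v Hv) as [(a' & b' & ? & ? & E')|(a' & ? & E')];
        rewrite E in E'; [injection E' as -> ->; auto|discriminate]. }
    apply rt_trans with [NT a; NT b].
    + apply rt_step. exists [], v, [], [NT a; NT b]. split; [|simpl; auto].
      rewrite <- E. now apply slp_rhs_in.
    + rewrite map_app. apply (derives_app G [NT a] _ [NT b] _); auto.
Qed.

Definition productive (G : cfg) (x : list symbol) : Prop :=
  forall v, In (NT v) x -> exists u, expands G v u.

(** A nonterminal has an expansion exactly if all nonterminals of its unique right-hand side do, so
    a derivation step preserves productivity in both directions. *)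
Lemma productive_step (G : cfg) (x y : list symbol) :
  is_slp G -> step G x y -> productive G x <-> productive G y.
Proof.
  intros HG (l & v & r & alpha & Hin & -> & ->).
  destruct (slp_rule_rhs G v alpha HG Hin) as [Hv ->].
  assert (Hiff : (exists u, expands G v u) <-> productive G (rhs G v)).
  { split.
    - intros (u & Hu) w Hw. destruct Hu as [? ? E|? ? ? ? ? E]; rewrite E in Hw; simpl in Hw.
      + destruct Hw as [Hw|[]]. discriminate.
      + destruct Hw as [Hw|[Hw|[]]]; injection Hw as <-; eauto.
    - intros Hp. destruct HG as [_ Hf].
      destruct (Hf v Hv) as [(a & b & _ & _ & E)|(a & _ & E)].
      + destruct (Hp a) as (y & Hy); [rewrite E; simpl; auto|].
        destruct (Hp b) as (z & Hz); [rewrite E; simpl; auto|].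
        exists (y ++ z). eapply expands_pair; eauto.
      + exists [a]. now apply expands_leaf. }
  split; intros H w Hw.
  - rewrite !in_app_iff in Hw. destruct Hw as [Hw|[Hw|Hw]].
    + apply H. rewrite in_app_iff. auto.
    + apply Hiff; auto. apply H. rewrite in_app_iff. simpl. auto.
    + apply H. rewrite in_app_iff. simpl. auto.
  - rewrite in_app_iff in Hw. destruct Hw as [Hw|[Hw|Hw]].
    + apply H. rewrite in_app_iff. auto.
    + injection Hw as <-. apply Hiff. intros w Hw. apply H. rewrite !in_app_iff. auto.
    + apply H. rewrite !in_app_iff. auto.
Qed.

Lemma productive_derives (G : cfg) (x y : list symbol) :
  is_slp G -> derives G x y -> productive G x <-> productive G y.
Proof.
  intros HG H. induction H; [now apply productive_step|tauto|tauto].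
Qed.

(** Productivity travels backwards from the terminal string [w] to the start symbol, then forwards
    to a sentential form that contains [v]. *)
Lemma slp_expands (G : cfg) (v : nat) :
  is_slp G -> v < nvar G -> exists x, expands G v x.
Proof.
  intros HG Hv. pose proof HG as [[_ ((w & Hw) & Hreach & _)] _].
  destruct (Hreach v Hv) as (x & Hx & Hin).
  refine (proj1 (productive_derives G _ _ HG Hx) _ v Hin).
  apply (productive_derives G _ (map Tm w) HG); [now apply Hw|].
  intros u Hu. apply in_map_iff in Hu as (a & Ha & _). discriminate.
Qed.

(** Obtained by choice: this string serves the specification and is never computed. *)
Definition expansion (G : cfg) (v : nat) : list nat :=
  epsilon (inhabits []) (expands G v).

Lemma expansion_spec (G : cfg) (v : nat) :
  is_slp G -> v < nvar G -> expands G v (expansion G v).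
Proof. intros HG Hv. unfold expansion. apply epsilon_spec. now apply slp_expands. Qed.

Lemma expansion_leaf (G : cfg) (v a : nat) :
  is_slp G -> v < nvar G -> rhs G v = [Tm a] -> expansion G v = [a].
Proof.
  intros HG Hv E. eapply expands_functional; [now apply expansion_spec|].
  now apply expands_leaf.
Qed.

Lemma expansion_pair (G : cfg) (v a b : nat) :
  is_slp G -> v < nvar G -> a < nvar G -> b < nvar G -> rhs G v = [NT a; NT b] ->
  expansion G v = expansion G a ++ expansion G b.
Proof.
  intros HG Hv Ha Hb E. eapply expands_functional; [now apply expansion_spec|].
  eapply expands_pair; eauto using expansion_spec.
Qed.

Lemma expansion_start (G : cfg) (w : list nat) :
  is_slp G -> generates G w -> expansion G (start G) = w.
Proof.
  intros HG Hw. pose proof HG as [[(Hs & _) _] _].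
  apply Hw. apply expands_derives; auto. now apply expansion_spec.
Qed.

Lemma expansion_nonempty (G : cfg) (v : nat) :
  is_slp G -> v < nvar G -> 0 < length (expansion G v).
Proof. intros HG Hv. eapply expands_length. now apply expansion_spec. Qed.

Lemma expansion_letters (G : cfg) (v : nat) :
  is_slp G -> v < nvar G -> Forall (fun a => a < nsig G) (expansion G v).
Proof.
  intros HG Hv. pose proof (expansion_spec G v HG Hv) as H. revert Hv.
  induction H as [v a E|v a b y z E _ IHy _ IHz]; intros Hv;
    destruct HG as [_ Hf]; destruct (Hf v Hv) as [(a' & b' & ? & ? & E')|(a' & ? & E')];
    rewrite E in E'; try discriminate; injection E' as ->; subst.
  - auto.
  - apply Forall_app. auto.
Qed.

(** The rules are distinct pairs whose second component is determined by the first, so the left-hand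
    sides are distinct. *)
Lemma slp_length_rules (G : cfg) : is_slp G -> length (rules G) <= nvar G.
Proof.
  intros HG. rewrite <- (length_map fst), <- (length_seq (nvar G) 0).
  apply NoDup_incl_length.
  - pose proof HG as [[(_ & Hnd & _) _] _].
    assert (Hsub : forall r, In r (rules G) -> snd r = rhs G (fst r)).
    { intros [v alpha] Hr. now apply (slp_rule_rhs G v alpha HG). }
    induction Hnd as [|[v alpha] l Hr Hnd IH]; simpl; constructor.
    + intros Hin. apply in_map_iff in Hin as ([v' beta] & E & Hin). simpl in E. subst v'.
      pose proof (Hsub (v, alpha) (or_introl eq_refl)).
      pose proof (Hsub (v, beta) (or_intror Hin)). simpl in *. congruence.
    + apply IH. intros r H. apply Hsub. now right.
  - intros v Hv. apply in_map_iff in Hv as ([v' alpha] & <- & Hin).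
    apply in_seq. simpl. apply (slp_rule_rhs G v' alpha HG) in Hin. lia.
Qed.

Lemma slp_nvar_le_size (G : cfg) : is_slp G -> nvar G <= size G.
Proof.
  intros [_ Hf]. unfold size. rewrite <- (length_seq (nvar G) 0) at 1.
  assert (H : forall v, In v (seq 0 (nvar G)) -> 1 <= length (rhs G v)).
  { intros v Hv. apply in_seq in Hv.
    destruct (Hf v) as [(a & b & _ & _ & ->)|(a & _ & ->)]; simpl; lia. }
  induction (seq 0 (nvar G)) as [|v l IH]; simpl in *; [lia|].
  specialize (IH (fun v Hv => H v (or_intror Hv))). specialize (H v (or_introl eq_refl)). lia.
Qed.

(** * The dictionary as a trie *)

Definition letters (sig : nat) (x : list nat) : Prop := Forall (fun a => a < sig) x.

(* Node 1 is the root and node 0 a dead state; the child of [u] along [a] is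
   stored at [u * sig + a]. *)
Definition walk (sig : nat) (child : nat -> nat) (x : list nat) : nat :=
  fold_left (fun u a => child (u * sig + a)) x 1.

(** [nn] counts the allocated nodes, including the dead state and the root; rows beyond are
    uninitialized and therefore unconstrained. The value 0 of a child means that it is missing.
    Injectivity on live nodes ensures that marking or extending a node affects a single string. *)
Record trie (sig : nat) (child final : nat -> nat) (nn : nat) (D : list (list nat)) : Prop := {
  trie_size : 2 <= nn;
  trie_child : forall u a, u < nn -> a < sig -> child (u * sig + a) < nn;
  trie_dead : forall a, a < sig -> child a = 0;
  trie_dead_final : final 0 = 0;
  trie_final : forall x, letters sig x -> final (walk sig child x) = Nat.b2n (asb (In x D));
  trie_inj : forall x y, letters sig x -> letters sig y ->
    walk sig child x = walk sig child y -> walk sig child x <> 0 -> x = y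
}.

Lemma walk_snoc (sig : nat) (child : nat -> nat) (x : list nat) (a : nat) :
  walk sig child (x ++ [a]) = child (walk sig child x * sig + a).
Proof. unfold walk. now rewrite fold_left_app. Qed.

Lemma letters_snoc (sig : nat) (x : list nat) (a : nat) :
  letters sig (x ++ [a]) <-> letters sig x /\ a < sig.
Proof.
  unfold letters. rewrite Forall_app. split; intros [H1 H2]; split; auto.
  now inversion H2.
Qed.

Lemma walk_lt (sig : nat) (child final : nat -> nat) (nn : nat) (D : list (list nat)) (x : list nat) :
  trie sig child final nn D -> letters sig x -> walk sig child x < nn.
Proof.
  intros HT. induction x as [|a x IH] using rev_ind; intros Hx.
  - unfold walk. simpl. destruct HT. lia.
  - rewrite walk_snoc. apply letters_snoc in Hx as [Hx Ha]. apply (trie_child _ _ _ _ _ HT); auto.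
Qed.

Lemma cell_inj (n a b u v : nat) : a < n -> b < n -> u * n + a = v * n + b -> u = v /\ a = b.
Proof. intros Ha Hb H. apply (Nat.div_mod_unique n); lia. Qed.

(** * Attaching a child to a trie node *)

Section NewNode.

Context (sig : nat) (child final : nat -> nat) (nn : nat) (D : list (list nat)).
Context (pre : list nat) (a : nat).
Context (HT : trie sig child final nn D) (Hpre : letters sig pre) (Ha : a < sig)
  (Hu : walk sig child pre <> 0) (Hnone : child (walk sig child pre * sig + a) = 0).

Let child' : nat -> nat :=
  upd (block child (nn * sig) sig (fun _ => 0)) (walk sig child pre * sig + a) nn.

Lemma new_child (u b : nat) : u <= nn -> b < sig ->
  child' (u * sig + b) =
    if (u =? walk sig child pre) && (b =? a) then nn
    else if u =? nn then 0 else child (u * sig + b).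
Proof.
  intros Hun Hb. pose proof (walk_lt _ _ _ _ _ _ HT Hpre) as Hlt. unfold child', upd.
  destruct (Nat.eqb_spec (u * sig + b) (walk sig child pre * sig + a)) as [E|E].
  - apply cell_inj in E as [-> ->]; auto. now rewrite !Nat.eqb_refl.
  - destruct (Nat.eqb_spec u (walk sig child pre)), (Nat.eqb_spec b a); simpl; try congruence;
      destruct (Nat.eqb_spec u nn) as [->|Hne]; try (apply block_in; auto);
      apply block_out; left; nia.
Qed.

(** Extensions of [pre ++ [a]] run into the cleared row of the new node and thus die, as they did
    before. Any other string meets the modified cell only if it reaches the node of [pre], which
    injectivity forbids. *)
Lemma walk_new (x : list nat) : letters sig x ->
  walk sig child' x = if list_eq_dec Nat.eq_dec x (pre ++ [a]) then nn else walk sig child x.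
Proof.
  induction x as [|b x IH] using rev_ind; intros Hx.
  - destruct (list_eq_dec Nat.eq_dec [] (pre ++ [a])) as [E|_]; auto.
    symmetry in E. apply app_eq_nil in E as [_ E]. discriminate.
  - apply letters_snoc in Hx as [Hx Hb]. rewrite !walk_snoc, (IH Hx).
    pose proof (walk_lt _ _ _ _ _ _ HT Hpre) as Hlt.
    pose proof (walk_lt _ _ _ _ _ _ HT Hx) as Hlx.
    destruct (list_eq_dec Nat.eq_dec x (pre ++ [a])) as [->|Hne].
    + rewrite new_child by auto.
      destruct (Nat.eqb_spec nn (walk sig child pre)) as [|_]; [lia|]. simpl.
      rewrite Nat.eqb_refl, walk_snoc, Hnone. simpl. rewrite (trie_dead _ _ _ _ _ HT b Hb).
      destruct (list_eq_dec Nat.eq_dec _ _) as [E|_]; auto.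
      apply app_inj_tail in E as [E _]. apply (f_equal (@length nat)) in E.
      rewrite length_app in E. simpl in E. lia.
    + rewrite new_child by (auto; lia).
      destruct (list_eq_dec Nat.eq_dec (x ++ [b]) (pre ++ [a])) as [E|Hne'].
      { apply app_inj_tail in E as [-> ->]. now rewrite !Nat.eqb_refl. }
      destruct (Nat.eqb_spec (walk sig child x) (walk sig child pre)) as [E|_]; simpl;
        destruct (Nat.eqb_spec (walk sig child x) nn) as [|_]; try lia; auto.
      destruct (Nat.eqb_spec b a) as [->|_]; auto.
      apply (trie_inj _ _ _ _ _ HT) in E; auto; [|congruence]. now subst.
Qed.

(** The dictionary is unchanged: [pre ++ [a]] used to reach the dead state, which is not final, so
    it is not a word and its new node starts unmarked. *)
Lemma trie_new_node : trie sig child' (upd final nn 0) (nn + 1) D.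
Proof.
  pose proof (walk_lt _ _ _ _ _ _ HT Hpre) as Hlt.
  pose proof (trie_size _ _ _ _ _ HT) as Hnn.
  assert (Hpa : letters sig (pre ++ [a])) by (apply letters_snoc; auto).
  split.
  - lia.
  - intros u b Hun Hb. rewrite new_child by lia.
    destruct ((u =? walk sig child pre) && (b =? a)); [lia|].
    destruct (Nat.eqb_spec u nn); [lia|].
    pose proof (trie_child _ _ _ _ _ HT u b). lia.
  - intros b Hb. change b with (0 * sig + b). rewrite new_child by lia.
    destruct (Nat.eqb_spec 0 (walk sig child pre)); [congruence|].
    destruct (Nat.eqb_spec 0 nn); [lia|]. simpl. now apply (trie_dead _ _ _ _ _ HT).
  - rewrite upd_neq by lia. apply HT.
  - intros x Hx. rewrite walk_new by auto. destruct (list_eq_dec Nat.eq_dec _ _) as [->|Hne].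
    + rewrite upd_eq. rewrite <- (trie_final _ _ _ _ _ HT _ Hpa), walk_snoc, Hnone.
      symmetry. apply HT.
    + rewrite upd_neq; [now apply HT|]. pose proof (walk_lt _ _ _ _ _ _ HT Hx). lia.
  - intros x y Hx Hy. rewrite !walk_new by auto.
    pose proof (walk_lt _ _ _ _ _ _ HT Hx). pose proof (walk_lt _ _ _ _ _ _ HT Hy).
    destruct (list_eq_dec Nat.eq_dec x _) as [->|], (list_eq_dec Nat.eq_dec y _) as [->|]; auto; try lia.
    now apply HT.
Qed.

Lemma walk_new_prefix : walk sig child' pre = walk sig child pre.
Proof.
  rewrite walk_new by auto. destruct (list_eq_dec Nat.eq_dec _ _) as [E|]; auto.
  apply (f_equal (@length nat)) in E. rewrite length_app in E. simpl in E. lia.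
Qed.

End NewNode.

(** By injectivity no string other than [d] reaches the marked node. *)
Lemma trie_mark (sig : nat) (child final : nat -> nat) (nn : nat) (D : list (list nat)) (d : list nat) :
  trie sig child final nn D -> letters sig d -> walk sig child d <> 0 ->
  trie sig child (upd final (walk sig child d) 1) nn (D ++ [d]).
Proof.
  intros HT Hd Hne. destruct HT as [H1 H2 H3 H4 H5 H6]. split; auto.
  - rewrite upd_neq; auto.
  - intros x Hx. destruct (Nat.eq_dec (walk sig child x) (walk sig child d)) as [E|E].
    + rewrite E, upd_eq. apply H6 in E; auto; [|congruence]. subst x.
      rewrite (proj2 (asb_true _)); auto. apply in_or_app. simpl. auto.
    + rewrite upd_neq, H5 by auto. f_equal. apply asb_iff. rewrite in_app_iff. simpl.
      split; auto. intros [H|[->|[]]]; tauto.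
Qed.

Lemma trie_empty (sig : nat) (child final : nat -> nat) :
  (forall i, i < 2 * sig -> child i = 0) -> final 0 = 0 -> final 1 = 0 ->
  trie sig child final 2 [].
Proof.
  intros Hc H0 H1.
  assert (Hw : forall x, letters sig x -> x = [] \/ walk sig child x = 0).
  { induction x as [|a x IH] using rev_ind; [auto|]. intros Hx. right.
    apply letters_snoc in Hx as [Hx Ha]. rewrite walk_snoc. apply Hc.
    destruct (IH Hx) as [->| ->]; simpl; lia. }
  split; auto.
  - intros u a Hu Ha. rewrite Hc; [lia|nia].
  - intros a Ha. apply Hc. lia.
  - intros x Hx. rewrite (proj2 (asb_false _)) by auto.
    destruct (Hw x Hx) as [->| ->]; auto.
  - intros x y Hx Hy E Hne. destruct (Hw x Hx) as [->|]; [|congruence].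
    destruct (Hw y Hy) as [->|E2]; [auto|congruence].
Qed.

(** * Symbolic evaluation of states, and lists stored in consecutive cells *)

#[local] Arguments upd {A} f !i v !j.

Local Ltac sim := cbn [reg arr set_reg set_arr set_block val bin_val bin_fits fits cost upd Nat.eqb].

Local Notation EAdd := (Bin OAdd).
Local Notation ESub := (Bin OSub).
Local Notation EMul := (Bin OMul).
Local Notation ELt := (Bin OLt).
Local Notation EEq := (Bin OEq).

Local Infix ";;" := Seq (at level 60, right associativity).

Fixpoint segment (f : nat -> nat) (p : nat) (l : list nat) : Prop :=
  match l with
  | [] => True
  | x :: l => f p = x /\ segment f (p + 1) l
  end.

Lemma segment_app (f : nat -> nat) (p : nat) (l l' : list nat) :
  segment f p (l ++ l') <-> segment f p l /\ segment f (p + length l) l'.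
Proof.
  revert p. induction l as [|x l IH]; simpl; intros p.
  - rewrite Nat.add_0_r. tauto.
  - rewrite IH. replace (p + S (length l)) with (p + 1 + length l) by lia. tauto.
Qed.

Lemma segment_nth (f : nat -> nat) (p : nat) (l : list nat) :
  (forall i, i < length l -> f (p + i) = nth i l 0) -> segment f p l.
Proof.
  revert p. induction l as [|x l IH]; simpl; intros p H; auto. split.
  - rewrite <- (H 0) by lia. f_equal. lia.
  - apply IH. intros i Hi. rewrite <- (H (S i)) by lia. f_equal. lia.
Qed.

(** * Building the trie *)

(* Registers: 1 alphabet size, 2 number of words, 3 input position, 4 maximal
   length, 5 number of nodes, 6 word counter, 7 word length, 8 current node,
   9 letter counter, 10 letter.  Arrays: 0 input, 1 children, 2 final nodes. *)

Definition child_cell : expr := EAdd (EMul (Var 8) (Var 1)) (Var 10).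

(** The fresh row must be cleared because memory is uninitialized; this costs O(1) per node as the
    alphabet has bounded size. *)
Definition add_node : prog :=
  assign 11 (EMul (Var 5) (Var 1));;
  fill 1 11 1 (Num 0);;
  store 2 (Var 5) (Num 0);;
  store 1 child_cell (Var 5);;
  assign 5 (EAdd (Var 5) (Num 1)).

Definition descend : prog :=
  assign 10 (Cell 0 (Var 3));;
  assign 3 (EAdd (Var 3) (Num 1));;
  cond (Cell 1 child_cell) Skip add_node;;
  assign 8 (Cell 1 child_cell);;
  assign 9 (EAdd (Var 9) (Num 1)).

Definition insert_word : prog :=
  assign 7 (Cell 0 (Var 3));;
  assign 3 (EAdd (Var 3) (Num 1));;
  assign 4 (Cond (ELt (Var 4) (Var 7)) (Var 7) (Var 4));;
  assign 8 (Num 1);;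
  assign 9 (Num 0);;
  loop (ELt (Var 9) (Var 7)) descend;;
  store 2 (Var 8) (Num 1);;
  assign 6 (EAdd (Var 6) (Num 1)).

(** The dead state and the root exist from the start: the node counter begins at 2 and their two
    rows are cleared. The words begin at input position 2, after the alphabet size and the number of
    words. *)
Definition build_trie : prog :=
  assign 1 (Cell 0 (Num 0));;
  assign 2 (Cell 0 (Num 1));;
  assign 3 (Num 2);;
  assign 4 (Num 0);;
  assign 5 (Num 2);;
  assign 6 (Num 0);;
  assign 11 (Num 0);;
  assign 12 (EMul (Num 2) (Var 1));;
  fill 1 11 12 (Num 0);;
  store 2 (Num 0) (Num 0);;
  store 2 (Num 1) (Num 0);;
  loop (ELt (Var 6) (Var 2)) insert_word.

Definition building (sig : nat) (inp : nat -> nat) (D : list (list nat)) (s : state) : Prop :=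
  reg s 1 = sig /\ (forall i, arr s 0 i = inp i) /\ trie sig (arr s 1) (arr s 2) (reg s 5) D.

(** The current node has to be live: a child attached to node 0 would break [trie_dead]. *)
Lemma runs_descend (W sig : nat) (inp : nat -> nat) (D : list (list nat))
    (pre : list nat) (a : nat) (s : state) (Q : state -> Prop) :
  building sig inp D s -> letters sig pre -> a < sig ->
  reg s 8 = walk sig (arr s 1) pre -> reg s 8 <> 0 -> inp (reg s 3) = a ->
  (reg s 5 + 1) * (sig + 1) < 2 ^ W -> reg s 3 + 1 < 2 ^ W -> reg s 9 + 1 < 2 ^ W ->
  (forall s', building sig inp D s' ->
     (forall x, In x [2; 4; 6; 7] -> reg s' x = reg s x) ->
     reg s' 3 = reg s 3 + 1 -> reg s' 9 = reg s 9 + 1 ->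
     reg s' 8 = walk sig (arr s' 1) (pre ++ [a]) -> reg s' 8 <> 0 ->
     reg s' 5 <= reg s 5 + 1 -> Q s') ->
  runs W descend s (80 + 14 * sig) Q.
Proof.
  intros (Hsig & Hinp & HT) Hpre Ha Hu Hne Hpos HB HB3 HB9 HQ.
  pose proof (trie_size _ _ _ _ _ HT) as Hnn.
  pose proof (walk_lt _ _ _ _ _ _ HT Hpre) as Hlt. rewrite <- Hu in Hlt.
  assert (Hcell : reg s 8 * sig + a < reg s 5 * sig) by nia.
  assert (Hcell' : reg s 8 * sig < reg s 5 * sig) by nia.
  assert (HB' : reg s 5 * sig + sig < 2 ^ W) by nia.
  assert (HB5 : reg s 5 + 1 < 2 ^ W) by nia.
  eapply runs_le.
  { eapply runs_seq. apply runs_assign; sim; [lia|lia|]. rewrite Hinp, Hpos.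
    eapply runs_seq. apply runs_assign; sim; [lia|lia|].
    eapply runs_seq. apply runs_cond; unfold child_cell; sim; rewrite ?Hsig.
    { lia. }
    { intros Hc. eapply runs_le; [apply runs_skip|shelve].
      eapply runs_seq. apply runs_assign; unfold child_cell; sim; rewrite ?Hsig; [lia|lia|].
      apply runs_assign; sim; [lia|lia|].
      apply HQ; sim; auto.
      - split; sim; auto.
      - intros x [<-|[<-|[<-|[<-|[]]]]]; reflexivity.
      - rewrite walk_snoc, <- Hu. reflexivity.
      - lia. }
    { intros Hc. unfold add_node.
      eapply runs_seq. apply runs_assign; sim; rewrite ?Hsig; [lia|lia|].
      eapply runs_seq. eapply runs_fill; sim; try reflexivity; rewrite ?Hsig; [lia|lia|lia| |].
      { intros k Hk. sim. split; [lia|reflexivity]. }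
      eapply runs_seq. apply runs_store; sim; [lia|lia|].
      eapply runs_seq. apply runs_store; unfold child_cell; sim; rewrite ?Hsig; [lia|lia|].
      apply runs_assign; sim; [lia|lia|].
      eapply runs_seq. apply runs_assign; unfold child_cell; sim; rewrite ?Hsig; [lia|lia|].
      apply runs_assign; sim; [lia|lia|].
      rewrite Hu in Hc.
      pose proof (trie_new_node _ _ _ _ _ pre a HT Hpre Ha ltac:(congruence) Hc) as HT'.
      pose proof (walk_new_prefix _ _ _ _ _ pre a HT Hpre Ha ltac:(congruence) Hc) as Hw'.
      rewrite <- Hu in *.
      apply HQ; sim; auto.
      - split; sim; auto.
      - intros x [<-|[<-|[<-|[<-|[]]]]]; reflexivity.
      - rewrite walk_snoc, Hw'. reflexivity.
      - rewrite upd_eq. lia. } }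
  Unshelve. all: unfold child_cell; sim; rewrite ?Hsig; lia.
Qed.

(** Each letter adds at most one node, and the current node remains live, so that [trie_mark]
    applies after the last letter. *)
Lemma runs_insert_word (W sig : nat) (inp : nat -> nat) (D : list (list nat))
    (d : list nat) (s : state) (Q : state -> Prop) :
  building sig inp D s -> letters sig d -> segment inp (reg s 3) (length d :: d) ->
  (reg s 5 + length d + 1) * (sig + 1) < 2 ^ W -> reg s 3 + length d + 1 < 2 ^ W ->
  reg s 6 + 1 < 2 ^ W ->
  (forall s', building sig inp (D ++ [d]) s' -> reg s' 2 = reg s 2 ->
     reg s' 3 = reg s 3 + 1 + length d -> reg s' 4 = max (reg s 4) (length d) ->
     reg s' 5 <= reg s 5 + length d -> reg s' 6 = reg s 6 + 1 -> Q s') ->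
  runs W insert_word s (40 + length d * (84 + 14 * sig)) Q.
Proof.
  intros (Hsig & Hinp & HT) Hd [Hlen Hseg] HB HB3 HB6 HQ.
  assert (H1 : 1 < 2 ^ W) by lia.
  assert (HB5 : reg s 5 + length d + 1 < 2 ^ W) by nia.
  pose proof (trie_size _ _ _ _ _ HT) as Hnn.
  eapply runs_le.
  { unfold insert_word.
    eapply runs_seq. apply runs_assign; sim; [lia|lia|]. rewrite Hinp, Hlen.
    eapply runs_seq. apply runs_assign; sim; [lia|lia|].
    eapply runs_seq. apply runs_assign; sim; [lia|lia|].
    eapply runs_seq. apply runs_assign; sim; [lia|lia|].
    eapply runs_seq. apply runs_assign; sim; [lia|lia|].
    eapply runs_seq.
    apply (runs_loop W _ _ (fun k s' => exists dp dr, d = dp ++ dr /\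
      k = length dr * (84 + 14 * sig) /\ building sig inp D s' /\
      reg s' 9 = length dp /\ reg s' 8 = walk sig (arr s' 1) dp /\ reg s' 8 <> 0 /\
      reg s' 3 = reg s 3 + 1 + length dp /\ reg s' 5 <= reg s 5 + length dp /\
      reg s' 7 = length d /\ reg s' 2 = reg s 2 /\ reg s' 6 = reg s 6 /\
      reg s' 4 = max (reg s 4) (length d))).
    2:{ exists [], d. split; [auto|]. split; [auto|].
        split; [split; [|split]; sim; auto|]. sim. simpl length.
        repeat (split; [solve [auto | lia]|]).
        destruct (Nat.ltb_spec (reg s 4) (length d)); cbn [Nat.b2n Nat.eqb]; lia. }
    intros k s' (dp & dr & E & -> & Hb & R9 & R8 & Hne & R3 & R5 & R7 & R2 & R6 & R4).
    assert (El : length d = length dp + length dr) by (rewrite E; apply length_app).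
    sim. rewrite R9, R7. split; [lia|].
    destruct (Nat.ltb_spec (length dp) (length d)) as [Hlt|Hge];
      (split; intros Hz); try discriminate; try (now destruct Hz).
    - destruct dr as [|a dr]; [simpl in El; lia|].
      exists (80 + 14 * sig), (length dr * (84 + 14 * sig)).
      split; [cbn [length]; rewrite Nat.mul_succ_l; sim; lia|].
      pose proof Hd as Hd'. rewrite E in Hd', Hseg. unfold letters in Hd'.
      apply Forall_app in Hd' as [Hdp Hdr]. inversion Hdr as [|? ? Ha Hdr']. subst x l.
      apply segment_app in Hseg as [_ [Hga _]]. simpl in El.
      apply (runs_descend W sig inp D dp a); auto; rewrite ?R3; auto; try lia.
      { nia. }
      intros s2 Hb2 Hsame P3 P9 P8 Pne P5.
      exists (dp ++ [a]), dr. rewrite <- app_assoc. split; [auto|]. split; [auto|].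
      rewrite (Hsame 2), (Hsame 4), (Hsame 6), (Hsame 7) by (simpl; auto).
      rewrite length_app. cbn [length].
      repeat (split; [solve [auto | lia]|]). auto.
    - destruct dr as [|a dr]; [|simpl in El; lia]. rewrite app_nil_r in E. subst dp.
      clear Hz Hge El. destruct Hb as (Hsig' & Hinp' & HT').
      eapply runs_seq. apply runs_store; sim; [lia|lia|].
      apply runs_assign; sim; [lia|lia|].
      apply HQ; sim; auto; try lia.
      split; [auto|]. split; [auto|]. sim. rewrite R8 in *. now apply trie_mark. }
  sim. lia.
Qed.

Lemma total_length_app (D E : list (list nat)) :
  total_length (D ++ E) = total_length D + total_length E.
Proof. unfold total_length. now rewrite map_app, list_sum_app. Qed.

Lemma max_length_app (D E : list (list nat)) :
  max_length (D ++ E) = max (max_length D) (max_length E).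
Proof. unfold max_length. now rewrite map_app, list_max_app. Qed.

Lemma runs_build_trie (W sig : nat) (inp : nat -> nat) (D : list (list nat))
    (s : state) (Q : state -> Prop) :
  (forall i, arr s 0 i = inp i) -> segment inp 0 (sig :: encode_dictionary D) ->
  Forall (letters sig) D ->
  (total_length D + 3) * (sig + 1) < 2 ^ W -> 2 + length (encode_dictionary D) < 2 ^ W ->
  length D < 2 ^ W ->
  (forall s', building sig inp D s' -> reg s' 3 = 1 + length (encode_dictionary D) ->
     reg s' 4 = max_length D -> reg s' 5 <= 2 + total_length D -> Q s') ->
  runs W build_trie s
    (80 + 28 * sig + length D * 44 + total_length D * (84 + 14 * sig)) Q.
Proof.
  intros Hinp (Hsig & HK & Hseg) HD HB HB3 HBK HQ. simpl in HK, Hseg.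
  assert (HB0 : 3 < 2 ^ W) by nia.
  assert (HB2 : 2 * sig < 2 ^ W) by nia.
  eapply runs_le.
  { unfold build_trie.
    eapply runs_seq. apply runs_assign; sim; [lia|lia|]. rewrite Hinp, Hsig.
    eapply runs_seq. apply runs_assign; sim; [lia|lia|]. rewrite Hinp, HK.
    do 5 (eapply runs_seq; apply runs_assign; sim; [lia|lia|]).
    eapply runs_seq. apply runs_assign; sim; [lia|lia|].
    eapply runs_seq. eapply runs_fill; sim; try reflexivity; [lia|lia|lia| |].
    { intros k Hk. sim. split; [lia|reflexivity]. }
    do 2 (eapply runs_seq; apply runs_store; sim; [lia|lia|]).
    apply (runs_loop W _ _ (fun k s' => exists Dp Dr, D = Dp ++ Dr /\
      k = length Dr * 44 + total_length Dr * (84 + 14 * sig) /\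
      building sig inp Dp s' /\ reg s' 2 = length D /\ reg s' 6 = length Dp /\
      segment inp (reg s' 3) (flat_map (fun d => length d :: d) Dr) /\
      reg s' 3 + length (flat_map (fun d => length d :: d) Dr) = 1 + length (encode_dictionary D) /\
      reg s' 4 = max_length Dp /\ reg s' 5 <= 2 + total_length Dp)).
    2:{ exists [], D. split; [auto|]. split; [reflexivity|].
        split.
        { split; [|split]; sim; auto. apply trie_empty.
          - intros i Hi. apply (block_in _ 0 (2 * sig) _ i Hi).
          - reflexivity.
          - reflexivity. }
        sim. repeat (split; [solve [auto | simpl; lia]|]). simpl. lia. }
    intros k s' (Dp & Dr & E & -> & Hb & R2 & R6 & Hs & R3 & R4 & R5).
    sim. rewrite R2, R6. split; [lia|].
    assert (El : length D = length Dp + length Dr) by (rewrite E; apply length_app).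
    assert (Et : total_length D = total_length Dp + total_length Dr)
      by (rewrite E; apply total_length_app).
    destruct (Nat.ltb_spec (length Dp) (length D)) as [Hlt|Hge];
      (split; intros Hz); try discriminate; try (now destruct Hz); clear Hz.
    - destruct Dr as [|d Dr]; [simpl in El; lia|].
      exists (40 + length d * (84 + 14 * sig)),
        (length Dr * 44 + total_length Dr * (84 + 14 * sig)).
      change (total_length (d :: Dr)) with (length d + total_length Dr) in *.
      cbn [flat_map] in Hs, R3. apply segment_app in Hs as [Hs1 Hs2].
      rewrite length_app in R3. cbn [length] in *.
      split; [lia|].
      rewrite E in HD. apply Forall_app in HD as [_ HDr]. inversion HDr as [|? ? Hd _]. subst x l.
      apply (runs_insert_word W sig inp Dp d); auto; try lia; [nia|].
      intros s2 Hb2 P2 P3 P4 P5 P6.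
      exists (Dp ++ [d]), Dr. rewrite <- app_assoc. split; [auto|]. split; [auto|]. split; [auto|].
      rewrite length_app, max_length_app, total_length_app.
      replace (reg s' 3 + S (length d)) with (reg s2 3) in Hs2 by lia.
      split; [congruence|]. split; [simpl; lia|]. split; [exact Hs2|]. split; [lia|].
      split; [rewrite P4, R4; unfold max_length; simpl; lia|].
      unfold total_length at 2. simpl. lia.
    - destruct Dr as [|a Dr]; [|simpl in El; lia]. rewrite app_nil_r in E. subst Dp.
      apply HQ; auto. cbn [flat_map] in R3. change (length []) with 0 in R3. lia. }
  sim. lia.
Qed.

(** * Reading the grammar *)

(* Registers: 3 input position, 6 rule counter, 13 start symbol, 14 number of
   rules, 15 nonterminal.  Arrays: 3 kind of rule (0 for a terminal), 4 and 5
   right-hand side, 6 flags of the nonterminals already evaluated. *)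

Definition load_rule : prog :=
  assign 15 (Cell 0 (Var 3));;
  store 6 (Var 15) (Num 0);;
  store 4 (Var 15) (Cell 0 (EAdd (Var 3) (Num 3)));;
  cond (EEq (Cell 0 (EAdd (Var 3) (Num 1))) (Num 1))
    (store 3 (Var 15) (Num 0);;
     assign 3 (EAdd (Var 3) (Num 4)))
    (store 3 (Var 15) (Num 1);;
     store 5 (Var 15) (Cell 0 (EAdd (Var 3) (Num 5)));;
     assign 3 (EAdd (Var 3) (Num 6)));;
  assign 6 (EAdd (Var 6) (Num 1)).

Definition load_grammar : prog :=
  assign 13 (Cell 0 (EAdd (Var 3) (Num 1)));;
  assign 14 (Cell 0 (EAdd (Var 3) (Num 2)));;
  assign 3 (EAdd (Var 3) (Num 3));;
  assign 6 (Num 0);;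
  loop (ELt (Var 6) (Var 14)) load_rule.

Definition stored (s : state) (v : nat) (alpha : list symbol) : Prop :=
  match alpha with
  | [Tm a] => arr s 3 v = 0 /\ arr s 4 v = a
  | [NT a; NT b] => arr s 3 v = 1 /\ arr s 4 v = a /\ arr s 5 v = b
  | _ => False
  end.

(** In an SLP the length of the right-hand side, at offset 1, tells the two kinds of rule apart.
    Each symbol is a tag followed by a value, so the values are at offsets 3 and 5, and a rule takes
    4 or 6 cells. *)
Lemma runs_load_rule (W : nat) (inp : nat -> nat) (v : nat) (alpha : list symbol)
    (s : state) (Q : state -> Prop) :
  (forall i, arr s 0 i = inp i) -> segment inp (reg s 3) (encode_rule (v, alpha)) ->
  (exists a b, alpha = [NT a; NT b]) \/ (exists a, alpha = [Tm a]) ->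
  reg s 3 + 6 < 2 ^ W -> reg s 6 + 1 < 2 ^ W ->
  (forall s', (forall a i, a <= 2 -> arr s' a i = arr s a i) ->
     (forall x, In x [1; 4; 5; 13; 14] -> reg s' x = reg s x) ->
     reg s' 3 = reg s 3 + length (encode_rule (v, alpha)) -> reg s' 6 = reg s 6 + 1 ->
     stored s' v alpha -> arr s' 6 v = 0 ->
     (forall u beta, u <> v -> stored s u beta -> stored s' u beta) ->
     (forall u, u <> v -> arr s' 6 u = arr s 6 u) -> Q s') ->
  runs W load_rule s 60 Q.
Proof.
  intros Hinp Hseg Halpha HB HB6 HQ. simpl in Hseg. destruct Hseg as (E0 & E1 & Hseg).
  assert (H3 : inp (reg s 3 + 3) = match alpha with NT a :: _ | Tm a :: _ => a | [] => 0 end).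
  { destruct Halpha as [(a & b & ->)|(a & ->)]; simpl in Hseg; destruct Hseg as (_ & E & _);
      rewrite <- E; f_equal; lia. }
  assert (Hlow : forall a, a <= 2 -> a = 0 \/ a = 1 \/ a = 2) by lia.
  eapply runs_le.
  { unfold load_rule.
    eapply runs_seq. apply runs_assign; sim; [lia|lia|]. rewrite Hinp, E0.
    eapply runs_seq. apply runs_store; sim; [lia|lia|].
    eapply runs_seq. apply runs_store; sim; [lia|lia|]. rewrite Hinp, H3.
    eapply runs_seq. apply (runs_cond W _ _ _ _ 24); sim; [lia| |]; rewrite Hinp, E1; intros Hc.
    - destruct Halpha as [(a & b & ->)|(a & ->)]; [now destruct Hc|].
      eapply runs_le; [|shelve].
      eapply runs_seq. apply runs_store; sim; [lia|lia|].
      apply runs_assign; sim; [lia|lia|].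
      apply runs_assign; sim; [lia|lia|].
      apply HQ; sim; auto.
      + intros b i Hb. destruct (Hlow b Hb) as [-> | [-> | ->]]; reflexivity.
      + intros x [<-|[<-|[<-|[<-|[<-|[]]]]]]; reflexivity.
      + unfold stored; sim. rewrite !upd_eq. auto.
      + now rewrite upd_eq.
      + intros u beta Hu. unfold stored; sim. now rewrite !upd_neq by auto.
      + intros u Hu. now rewrite !upd_neq by auto.
    - destruct Halpha as [(a & b & ->)|(a & ->)]; [|discriminate].
      eapply runs_le; [|shelve].
      eapply runs_seq. apply runs_store; sim; [lia|lia|].
      eapply runs_seq. apply runs_store; sim; [lia|lia|]. rewrite Hinp.
      apply runs_assign; sim; [lia|lia|].
      apply runs_assign; sim; [lia|lia|].
      simpl in Hseg. destruct Hseg as (_ & _ & _ & E5 & _).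
      replace (reg s 3 + 1 + 1 + 1 + 1 + 1) with (reg s 3 + 5) in E5 by lia. rewrite E5.
      apply HQ; sim; auto.
      + intros c i Hc'. destruct (Hlow c Hc') as [-> | [-> | ->]]; reflexivity.
      + intros x [<-|[<-|[<-|[<-|[<-|[]]]]]]; reflexivity.
      + unfold stored; sim. rewrite !upd_eq. auto.
      + now rewrite upd_eq.
      + intros u beta Hu. unfold stored; sim. now rewrite !upd_neq by auto.
      + intros u Hu. now rewrite !upd_neq by auto. }
  Unshelve. all: sim; lia.
Qed.

Lemma length_rules_le_encode (G : cfg) : length (rules G) + 3 <= length (encode_cfg G).
Proof.
  unfold encode_cfg. cbn [length].
  assert (length (rules G) <= length (flat_map encode_rule (rules G))); [|lia].
  induction (rules G) as [|r l IH]; [auto|].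
  cbn [flat_map length]. rewrite length_app. unfold encode_rule at 1. cbn [length]. lia.
Qed.

Lemma runs_load_grammar (W : nat) (inp : nat -> nat) (G : cfg) (s : state) (Q : state -> Prop) :
  is_slp G -> (forall i, arr s 0 i = inp i) -> segment inp (reg s 3) (encode_cfg G) ->
  reg s 3 + length (encode_cfg G) + 6 < 2 ^ W ->
  (forall s', (forall a i, a <= 2 -> arr s' a i = arr s a i) ->
     reg s' 1 = reg s 1 -> reg s' 4 = reg s 4 -> reg s' 5 = reg s 5 -> reg s' 13 = start G ->
     (forall v, v < nvar G -> stored s' v (rhs G v) /\ arr s' 6 v = 0) -> Q s') ->
  runs W load_grammar s (40 + nvar G * 64) Q.
Proof.
  intros HG Hinp (_ & Hs & Hn & Hseg) HB HQ.
  replace (reg s 3 + 1 + 1) with (reg s 3 + 2) in * by lia.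
  replace (reg s 3 + 2 + 1) with (reg s 3 + 3) in * by lia.
  pose proof (length_rules_le_encode G) as HL.
  pose proof (slp_length_rules G HG) as Hnv.
  eapply runs_le.
  { unfold load_grammar.
    eapply runs_seq. apply runs_assign; sim; [lia|lia|]. rewrite Hinp, Hs.
    eapply runs_seq. apply runs_assign; sim; [lia|lia|]. rewrite Hinp, Hn.
    eapply runs_seq. apply runs_assign; sim; [lia|lia|].
    eapply runs_seq. apply runs_assign; sim; [lia|lia|].
    apply (runs_loop W _ _ (fun k s' => exists Rp Rr, rules G = Rp ++ Rr /\
      k = length Rr * 64 /\ (forall a i, a <= 2 -> arr s' a i = arr s a i) /\
      reg s' 1 = reg s 1 /\ reg s' 4 = reg s 4 /\ reg s' 5 = reg s 5 /\ reg s' 13 = start G /\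
      reg s' 14 = length (rules G) /\ reg s' 6 = length Rp /\
      segment inp (reg s' 3) (flat_map encode_rule Rr) /\
      reg s' 3 + length (flat_map encode_rule Rr) = reg s 3 + length (encode_cfg G) /\
      (forall v alpha, In (v, alpha) Rp -> stored s' v alpha /\ arr s' 6 v = 0))).
    2:{ exists [], (rules G). split; [auto|]. split; [reflexivity|]. split; [auto|]. sim.
        repeat (split; [solve [auto]|]).
        split; [unfold encode_cfg; cbn [length]; lia|]. intros v alpha []. }
    intros k s' (Rp & Rr & E & -> & Ha & R1 & R4 & R5 & R13 & R14 & R6 & Hsg & R3 & Hst).
    sim. rewrite R6, R14. split; [lia|].
    assert (El : length (rules G) = length Rp + length Rr) by (rewrite E; apply length_app).
    destruct (Nat.ltb_spec (length Rp) (length (rules G))) as [Hlt|Hge];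
      (split; intros Hz); try discriminate; try (now destruct Hz); clear Hz.
    - destruct Rr as [|[v alpha] Rr]; [simpl in El; lia|].
      exists 60, (length Rr * 64). split; [cbn [length]; lia|].
      cbn [flat_map] in Hsg, R3. apply segment_app in Hsg as [Hs1 Hs2].
      rewrite length_app in R3.
      assert (Hin : forall r, In r (Rp ++ (v, alpha) :: Rr) -> In r (rules G)) by (rewrite E; auto).
      destruct (slp_rule_rhs G v alpha HG) as [Hv Hal]; [apply Hin, in_or_app; simpl; auto|].
      assert (Hl : 2 <= length (encode_rule (v, alpha))) by (simpl; lia).
      assert (Hform : (exists a b, alpha = [NT a; NT b]) \/ (exists a, alpha = [Tm a])).
      { rewrite Hal. destruct HG as [_ Hf].
        destruct (Hf v Hv) as [(a & b & _ & _ & ->)|(a & _ & ->)]; eauto. }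
      apply (runs_load_rule W inp v alpha); auto.
      { intros i. rewrite Ha by lia. apply Hinp. } { lia. } { lia. }
      intros s2 Ha2 Hr2 P3 P6 Hst2 Hd2 Hoth Hothd.
      rewrite <- P3 in Hs2.
      exists (Rp ++ [(v, alpha)]), Rr. rewrite <- app_assoc. split; [auto|]. split; [auto|].
      split. { intros a i Hai. rewrite Ha2; auto. }
      rewrite (Hr2 1), (Hr2 4), (Hr2 5), (Hr2 13), (Hr2 14) by (simpl; auto 10).
      rewrite length_app. change (length [(v, alpha)]) with 1.
      do 5 (split; [auto|]). split; [lia|]. split; [auto|]. split; [lia|].
      intros u beta Hu. apply in_app_iff in Hu as [Hu|[Hu|[]]].
      + destruct (Hst u beta Hu) as [H1 H2].
        (* Overwriting an entry of the same nonterminal is harmless, because both rules have the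
           right-hand side [rhs G v]. *)
        destruct (Nat.eq_dec u v) as [->|Hne]; [|split; [auto|rewrite Hothd; auto]].
        destruct (slp_rule_rhs G v beta HG) as [_ Hbe]; [apply Hin, in_or_app; auto|].
        split; [|auto]. congruence.
      + injection Hu as <- <-. auto.
    - destruct Rr as [|r Rr]; [|simpl in El; lia]. rewrite app_nil_r in E.
      apply HQ; auto. intros v Hv. apply Hst. rewrite <- E. now apply slp_rhs_in. }
  sim. lia.
Qed.

(** * Evaluating one nonterminal *)

(* Registers: 1 alphabet size, 4 matrix dimension [m], 15 the nonterminal [v],
   17 and 18 its right-hand side, 19 and 20 the lengths of their expansions
   (cut off at [m]), 22 to 27 the offsets of the rows of these three
   nonterminals, 30 [m * m].  Arrays: 8 lengths, 9 prefixes, 10 reversed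
   suffixes, 11 matrices, 12 and 13 tables of trie nodes, 100 input and output
   of the matrix multiplication. *)

Local Notation row_index := (Bin ODiv (Var 99) (Var 4)).
Local Notation col_index := (Bin OMod (Var 99) (Var 4)).

Lemma div_mod_pair (m p q : nat) : q < m -> (p * m + q) / m = p /\ (p * m + q) mod m = q.
Proof.
  intros Hq. split.
  - symmetry. apply (Nat.div_unique _ _ _ q); lia.
  - symmetry. apply (Nat.mod_unique _ _ p q); lia.
Qed.

Lemma div_mod_square (m t : nat) : t < m * m ->
  t / m < m /\ t mod m < m /\ t = t / m * m + t mod m.
Proof.
  intros Ht. assert (Hm : m <> 0) by nia.
  split; [apply Nat.Div0.div_lt_upper_bound; lia|].
  split; [now apply Nat.mod_upper_bound|]. rewrite (Nat.div_mod t m) at 1 by auto. lia.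
Qed.

Lemma b2n_eqb0 (b : bool) : (Nat.b2n b =? 0) = negb b.
Proof. now destruct b. Qed.

Local Ltac decide_conds :=
  rewrite ?b2n_eqb0;
  repeat match goal with
  | |- context [?x <? ?y] => destruct (Nat.ltb_spec x y); cbn [negb Nat.b2n andb]
  | |- context [?x <=? ?y] => destruct (Nat.leb_spec x y); cbn [negb Nat.b2n andb]
  | |- context [?x =? ?y] => destruct (Nat.eqb_spec x y); cbn [negb Nat.b2n andb]
  end.

Local Ltac split_fits :=
  repeat split; intros;
  repeat match goal with
  | H : Nat.b2n (?x <? ?y) = 0 |- _ => destruct (Nat.ltb_spec x y) in H; [discriminate H|clear H]
  | H : Nat.b2n (?x =? ?y) = 0 |- _ => destruct (Nat.eqb_spec x y) in H; [discriminate H|clear H]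
  | H : Nat.b2n (?x <? ?y) <> 0 |- _ => destruct (Nat.ltb_spec x y) in H; [clear H|now destruct H]
  | H : Nat.b2n (?x =? ?y) <> 0 |- _ => destruct (Nat.eqb_spec x y) in H; [clear H|now destruct H]
  end; try lia.

(** * Trie nodes of the strings around a border *)

Definition suffix (p : nat) (y : list nat) : list nat := rev (firstn p (rev y)).

Lemma length_suffix (p : nat) (y : list nat) : p <= length y -> length (suffix p y) = p.
Proof. intros H. unfold suffix. rewrite length_rev, length_firstn, length_rev. lia. Qed.

(** Array 10 stores letters counted from the end, whence the index into [rev y]. *)
Lemma suffix_nth (p q : nat) (y : list nat) : q < p -> p <= length y ->
  nth q (suffix p y) 0 = nth (p - S q) (rev y) 0.
Proof.
  intros Hq Hp. unfold suffix. rewrite rev_nth; rewrite length_firstn, length_rev, Nat.min_l by lia;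
    [|lia].
  rewrite nth_firstn. destruct (Nat.ltb_spec (p - S q) p); auto. lia.
Qed.

Lemma letters_suffix (sig p : nat) (y : list nat) : letters sig y -> letters sig (suffix p y).
Proof.
  intros H. apply Forall_rev. apply Forall_forall. intros x Hx.
  apply (proj1 (Forall_forall _ _) H). apply in_rev.
  rewrite <- (firstn_skipn p (rev y)). apply in_or_app. auto.
Qed.

Lemma letters_firstn (sig q : nat) (z : list nat) : letters sig z -> letters sig (firstn q z).
Proof.
  intros H. apply Forall_forall. intros x Hx.
  apply (proj1 (Forall_forall _ _) H). rewrite <- (firstn_skipn q z). apply in_or_app. auto.
Qed.

Lemma letters_nth (sig k : nat) (z : list nat) : letters sig z -> k < length z -> nth k z 0 < sig.
Proof. intros H Hk. apply (proj1 (Forall_forall _ _) H). now apply nth_In. Qed.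

Lemma firstn_snoc (q : nat) (z : list nat) : q < length z ->
  firstn (S q) z = firstn q z ++ [nth q z 0].
Proof.
  revert q. induction z as [|a z IH]; simpl; intros q Hq; [lia|].
  destruct q as [|q]; [auto|]. rewrite (IH q) by lia. reflexivity.
Qed.

(** For [q <= p], cell [(p, q)] is the node of the first [q] letters of the suffix of length [p].
    The preceding cell of the table is [(p, q - 1)], so one trie step per cell handles all suffixes
    in O(m^2). *)
Definition suffix_nodes : prog :=
  fill 12 28 30
    (Cond (ELt (Var 19) row_index) (Num 0)
    (Cond (ELt row_index col_index) (Num 0)
    (Cond (EEq col_index (Num 0)) (Num 1)
      (Cell 1 (EAdd (EMul (Cell 12 (ESub (Var 99) (Num 1))) (Var 1))
                   (Cell 10 (EAdd (Var 24) (ESub row_index col_index)))))))).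

(** Row [p] starts with the whole suffix of length [p], found on the diagonal of the first table:
    the address of [(p, 0)] plus [p] is that of [(p, p)]. Each further cell appends a letter of the
    prefix of the right string. *)
Definition bridge_nodes : prog :=
  fill 13 28 30
    (Cond (EEq col_index (Num 0)) (Cell 12 (EAdd (Var 99) row_index))
    (Cond (ELt (Var 20) col_index) (Num 0)
      (Cell 1 (EAdd (EMul (Cell 13 (ESub (Var 99) (Num 1))) (Var 1))
                   (Cell 9 (EAdd (Var 25) (ESub col_index (Num 1)))))))).

Definition suffix_node (sig : nat) (child : nat -> nat) (la : nat) (y : list nat) (p q : nat) : nat :=
  if (p <=? la) && (q <=? p) then walk sig child (firstn q (suffix p y)) else 0.

Definition bridge_node (sig : nat) (child : nat -> nat) (la lb : nat)
    (y z : list nat) (p q : nat) : nat :=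
  if (p <=? la) && (q <=? lb) then walk sig child (suffix p y ++ firstn q z) else 0.

Lemma suffix_node_lt (sig : nat) (child final : nat -> nat) (nn : nat) (D : list (list nat))
    (la : nat) (y : list nat) (p q : nat) :
  trie sig child final nn D -> letters sig y -> suffix_node sig child la y p q < nn.
Proof.
  intros HT Hy. pose proof (trie_size _ _ _ _ _ HT). unfold suffix_node.
  destruct (_ && _); [|lia]. apply (walk_lt _ _ _ _ _ _ HT).
  now apply letters_firstn, letters_suffix.
Qed.

Lemma bridge_node_lt (sig : nat) (child final : nat -> nat) (nn : nat) (D : list (list nat))
    (la lb : nat) (y z : list nat) (p q : nat) :
  trie sig child final nn D -> letters sig y -> letters sig z ->
  bridge_node sig child la lb y z p q < nn.
Proof.
  intros HT Hy Hz. pose proof (trie_size _ _ _ _ _ HT). unfold bridge_node.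
  destruct (_ && _); [|lia]. apply (walk_lt _ _ _ _ _ _ HT).
  apply Forall_app. split; [now apply letters_suffix|now apply letters_firstn].
Qed.

Lemma suffix_node_step (sig : nat) (child : nat -> nat) (la m : nat) (y : list nat) (p q : nat) :
  la = min (length y) m -> p < m -> p <= la -> q < p ->
  suffix_node sig child la y p (S q) =
    child (suffix_node sig child la y p q * sig + nth (p - S q) (rev y) 0).
Proof.
  intros Hla Hp Hpl Hq. unfold suffix_node.
  rewrite !(proj2 (Nat.leb_le _ _)) by lia. cbn [andb].
  rewrite firstn_snoc by (rewrite length_suffix; lia).
  now rewrite walk_snoc, suffix_nth by lia.
Qed.

Lemma bridge_node_step (sig : nat) (child final : nat -> nat) (nn : nat) (D : list (list nat))
    (la lb m : nat) (y z : list nat) (p q : nat) :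
  trie sig child final nn D -> letters sig z -> lb = min (length z) m -> S q <= lb ->
  bridge_node sig child la lb y z p (S q) =
    child (bridge_node sig child la lb y z p q * sig + nth q z 0).
Proof.
  intros HT Hz Hlb Hq. unfold bridge_node.
  rewrite (proj2 (Nat.leb_le (S q) _)), (proj2 (Nat.leb_le q _)) by lia.
  destruct (p <=? la); cbn [andb].
  - rewrite firstn_snoc, app_assoc, walk_snoc by lia. reflexivity.
  (* For [p] beyond the length of [y], the row starts in the dead state and stays there. *)
  - symmetry. apply (trie_dead _ _ _ _ _ HT). apply letters_nth; auto. lia.
Qed.

Lemma bridge_node_zero (sig : nat) (child : nat -> nat) (la lb m : nat) (y z : list nat) (p : nat) :
  la = min (length y) m ->
  bridge_node sig child la lb y z p 0 = suffix_node sig child la y p p.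
Proof.
  intros Hla. unfold bridge_node, suffix_node.
  rewrite (Nat.leb_refl p), (proj2 (Nat.leb_le 0 lb)) by lia.
  destruct (Nat.leb_spec p la); cbn [andb]; auto.
  rewrite app_nil_r, firstn_all2; auto. rewrite length_suffix; lia.
Qed.

Lemma runs_nodes (W sig m : nat) (D : list (list nat)) (y z : list nat)
    (s : state) (Q : state -> Prop) :
  trie sig (arr s 1) (arr s 2) (reg s 5) D -> letters sig y -> letters sig z ->
  reg s 1 = sig -> reg s 4 = m -> reg s 30 = m * m -> reg s 28 = 0 ->
  reg s 19 = min (length y) m -> reg s 20 = min (length z) m ->
  (forall k, k < min (length z) m -> arr s 9 (reg s 25 + k) = nth k z 0) ->
  (forall k, k < min (length y) m -> arr s 10 (reg s 24 + k) = nth k (rev y) 0) ->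
  0 < m -> m * m + 1 < 2 ^ W -> reg s 24 + m < 2 ^ W -> reg s 25 + m < 2 ^ W ->
  reg s 5 * sig < 2 ^ W ->
  (forall s', (forall x, x <= 98 -> reg s' x = reg s x) ->
     (forall a i, a <> 12 -> a <> 13 -> arr s' a i = arr s a i) ->
     (forall t, t < m * m -> arr s' 13 t =
        bridge_node sig (arr s 1) (reg s 19) (reg s 20) y z (t / m) (t mod m)) ->
     Q s') ->
  runs W (suffix_nodes;; bridge_nodes) s (14 + m * m * 110) Q.
Proof.
  intros HT Hy Hz Rsig Rm Rmm R28 Hla Hlb Hpre Hsuf Hm HBm HB24 HB25 HBn HQ.
  set (la := reg s 19) in *. set (lb := reg s 20) in *.
  eapply runs_le.
  { eapply runs_seq. unfold suffix_nodes.
    eapply (runs_fill W _ _ _ _ 0 (m * m) (fun t => suffix_node sig (arr s 1) la y (t / m) (t mod m)));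
      try lia.
    { intros t Ht. cbv zeta. sim. fold la. rewrite Rm, Rsig.
      destruct (div_mod_square m t Ht) as (Hp & Hq & Et).
      set (p := t / m) in *. set (q := t mod m) in *.
      assert (Hprev : q <> 0 -> block (arr s 12) 0 t
          (fun t => suffix_node sig (arr s 1) la y (t / m) (t mod m)) (t - 1)
          = suffix_node sig (arr s 1) la y p (q - 1)).
      { intros Hq0. rewrite (block_in _ 0 t _ (t - 1)) by lia.
        destruct (div_mod_pair m p (q - 1)) as [E1 E2]; [lia|].
        replace (t - 1) with (p * m + (q - 1)) by lia. now rewrite E1, E2. }
      pose proof (suffix_node_lt _ _ _ _ _ la y p (q - 1) HT Hy) as Hlt.
      assert (Hstep : q <> 0 -> p <= la -> q <= p ->
        suffix_node sig (arr s 1) la y p q =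
        arr s 1 (suffix_node sig (arr s 1) la y p (q - 1) * sig + arr s 10 (reg s 24 + (p - q)))).
      { intros H1 H2 H3. rewrite Hsuf by lia.
        replace q with (S (q - 1)) at 1 by lia. rewrite (suffix_node_step sig _ la m) by lia.
        do 2 f_equal. f_equal. lia. }
      assert (Hl : p <= la -> q <= p -> q <> 0 -> arr s 10 (reg s 24 + (p - q)) < sig).
      { intros H1 H2 H3. rewrite Hsuf by lia. apply letters_nth; [now apply Forall_rev|].
        rewrite length_rev. lia. }
      assert (H1 : 1 < 2 ^ W) by nia.
      split.
      - split_fits; rewrite Hprev by lia; [nia|]. specialize (Hl ltac:(lia) ltac:(lia) ltac:(lia)). nia.
      - decide_conds; rewrite ?Hprev, <- ?Hstep by lia; auto; unfold suffix_node; decide_conds;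
          try lia; auto.
        replace q with 0 by lia. reflexivity. }
    eapply (runs_fill W _ _ _ _ 0 (m * m)
      (fun t => bridge_node sig (arr s 1) la lb y z (t / m) (t mod m))); sim; try lia.
    { intros t Ht. cbv zeta. sim. fold la lb. rewrite Rm, Rsig.
      destruct (div_mod_square m t Ht) as (Hp & Hq & Et).
      set (p := t / m) in *. set (q := t mod m) in *.
      assert (Hdiag : q = 0 -> block (arr s 12) 0 (m * m)
          (fun t => suffix_node sig (arr s 1) la y (t / m) (t mod m)) (t + p)
          = bridge_node sig (arr s 1) la lb y z p q).
      { intros Hq0. rewrite (block_in _ 0 (m * m) _ (t + p)) by nia.
        destruct (div_mod_pair m p p) as [E1 E2]; [lia|].
        replace (t + p) with (p * m + p) by lia. rewrite E1, E2, Hq0.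
        symmetry. now apply (bridge_node_zero _ _ _ _ m). }
      assert (Hprev : q <> 0 -> block (arr s 13) 0 t
          (fun t => bridge_node sig (arr s 1) la lb y z (t / m) (t mod m)) (t - 1)
          = bridge_node sig (arr s 1) la lb y z p (q - 1)).
      { intros Hq0. rewrite (block_in _ 0 t _ (t - 1)) by lia.
        destruct (div_mod_pair m p (q - 1)) as [E1 E2]; [lia|].
        replace (t - 1) with (p * m + (q - 1)) by lia. now rewrite E1, E2. }
      pose proof (bridge_node_lt _ _ _ _ _ la lb y z p (q - 1) HT Hy Hz) as Hlt.
      assert (Hstep : q <> 0 -> q <= lb -> bridge_node sig (arr s 1) la lb y z p q =
        arr s 1 (bridge_node sig (arr s 1) la lb y z p (q - 1) * sig + arr s 9 (reg s 25 + (q - 1)))).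
      { intros H1 H2. rewrite Hpre by lia.
        replace q with (S (q - 1)) at 1 by lia.
        apply (bridge_node_step _ _ _ _ _ _ _ m _ _ _ _ HT); auto. lia. }
      assert (Hl : q <= lb -> q <> 0 -> arr s 9 (reg s 25 + (q - 1)) < sig).
      { intros H2 H3. rewrite Hpre by lia. apply letters_nth; auto. lia. }
      assert (H1 : 1 < 2 ^ W) by nia.
      split.
      - split_fits; try rewrite Hprev by lia; try nia.
      - decide_conds; rewrite ?Hprev, <- ?Hstep by lia; auto.
        unfold bridge_node. decide_conds; auto. lia. }
    apply HQ; sim.
    - intros x Hx. unfold upd. destruct (Nat.eqb_spec x 99); auto. lia.
    - intros a i Ha Hb. now rewrite !upd_neq by auto.
    - intros t Ht. now rewrite (block_in _ 0 (m * m) _ t Ht). }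
  sim. nia.
Qed.

(** For [p] and [q] below [m], comparing with a length cut off at [m] is the same as comparing with
    the length itself. *)
Lemma bridge_final (sig : nat) (child final : nat -> nat) (nn : nat) (D : list (list nat))
    (m : nat) (y z : list nat) (p q : nat) :
  trie sig child final nn D -> letters sig y -> letters sig z ->
  0 < p < m -> 0 < q < m ->
  final (bridge_node sig child (min (length y) m) (min (length z) m) y z p q) =
    Nat.b2n (asb (bridge D y z p q)).
Proof.
  intros HT Hy Hz Hp Hq. unfold bridge_node.
  destruct (Nat.leb_spec p (min (length y) m)) as [Hpy|Hpy];
    destruct (Nat.leb_spec q (min (length z) m)) as [Hqz|Hqz]; cbn [andb].
  2, 3, 4: rewrite (trie_dead_final _ _ _ _ _ HT), (proj2 (asb_false _)); auto;
    intros [H|(_ & _ & y' & s & t & z' & -> & -> & <- & <- & _)];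
    [lia|rewrite !length_app in *; lia].
  rewrite (trie_final _ _ _ _ _ HT)
    by (apply Forall_app; split; [now apply letters_suffix|now apply letters_firstn]).
  f_equal. apply asb_iff. split.
  - intros H. right. split; [lia|]. split; [lia|].
    exists (rev (skipn p (rev y))), (suffix p y), (firstn q z), (skipn q z).
    split; [unfold suffix; now rewrite <- rev_app_distr, firstn_skipn, rev_involutive|].
    split; [now rewrite firstn_skipn|]. split; [apply length_suffix; lia|].
    split; [rewrite length_firstn; lia|exact H].
  - intros [H|(_ & _ & y' & s & t & z' & -> & -> & <- & <- & H)]; [lia|].
    unfold suffix. rewrite rev_app_distr, !firstn_app, !length_rev, !Nat.sub_diag. simpl.
    rewrite !app_nil_r, !firstn_all2 by (rewrite ?length_rev; lia).
    now rewrite rev_involutive.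
Qed.

(** * The two matrix products for a pair *)

Lemma bool_mul_true (n : nat) (A B : nat -> nat -> bool) (i j : nat) :
  bool_mul n A B i j = true <-> exists k, k < n /\ A i k = true /\ B k j = true.
Proof.
  unfold bool_mul. rewrite existsb_exists. split.
  - intros (k & Hk & H). apply in_seq in Hk. apply andb_true_iff in H. exists k. split; [lia|auto].
  - intros (k & Hk & H1 & H2). exists k. rewrite in_seq, H1, H2. split; [lia|auto].
Qed.

(** Input and output of the routine share array 100: the dimension, then both operands, later
    replaced by the product. Registers above 99 and the other arrays from 100 on may come back with
    any contents. *)
Definition multiplies (mm : prog) (W m N : nat) : Prop :=
  forall A B s (Q : state -> Prop),
    reg s 100 = 1 + (m * m + m * m) -> arr s 100 0 = m ->
    (forall t, t < m * m -> arr s 100 (1 + t) = Nat.b2n (A (t / m) (t mod m))) ->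
    (forall t, t < m * m -> arr s 100 (1 + m * m + t) = Nat.b2n (B (t / m) (t mod m))) ->
    (forall s', (forall x, x <= 99 -> reg s' x = reg s x) ->
       (forall a i, a < 100 -> arr s' a i = arr s a i) ->
       (forall t, t < m * m -> arr s' 100 t = Nat.b2n (bool_mul m A B (t / m) (t mod m))) ->
       Q s') ->
    runs W mm s N Q.

(** The product [C * B_z] comes first. Its result occupies the beginning of array 100, so it is
    moved to the place of the second operand before [B_y] and the dimension are written over it.
    Registers 29 and 31 hold the offsets of the two operands. *)
Definition pair_product (mm : prog) : prog :=
  fill 100 29 30
    (Cond (EEq row_index (Num 0)) (EEq col_index (Num 0))
    (Cond (EEq col_index (Num 0)) (Num 0) (Cell 2 (Cell 13 (Var 99)))));;
  fill 100 31 30 (Cell 11 (EAdd (Var 27) (Var 99)));;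
  store 100 (Num 0) (Var 4);;
  assign 100 (EAdd (Num 1) (EAdd (Var 30) (Var 30)));;
  mm;;
  fill 100 31 30 (Cell 100 (Var 99));;
  fill 100 29 30 (Cell 11 (EAdd (Var 26) (Var 99)));;
  store 100 (Num 0) (Var 4);;
  assign 100 (EAdd (Num 1) (EAdd (Var 30) (Var 30)));;
  mm;;
  fill 11 23 30
    (Cond (ELt (Var 19) row_index)
      (Cell 11 (EAdd (Var 27) (EAdd (EMul (ESub row_index (Var 19)) (Var 4)) col_index)))
    (Cond (ELt (Var 20) col_index)
      (Cell 11 (EAdd (Var 26) (EAdd (EMul row_index (Var 4)) (ESub col_index (Var 20)))))
      (Cell 100 (Var 99)))).

Lemma ranges_disjoint (n u v j k : nat) :
  v + n <= u \/ u + n <= v -> j < n -> k < n -> u + k < v \/ v + j <= u + k.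
Proof. lia. Qed.

(** All three matrices of a pair are in array 11; the disjointness hypotheses let the last [fill]
    read the children while it writes the parent. *)
Lemma runs_pair_product (mm : prog) (W sig m N : nat) (D : list (list nat)) (y z : list nat)
    (s : state) (Q : state -> Prop) :
  multiplies mm W m N ->
  trie sig (arr s 1) (arr s 2) (reg s 5) D -> letters sig y -> letters sig z ->
  Forall (fun d => length d <= m) D ->
  reg s 4 = m -> reg s 30 = m * m -> reg s 29 = 1 -> reg s 31 = 1 + m * m ->
  reg s 19 = min (length y) m -> reg s 20 = min (length z) m ->
  (forall t, t < m * m -> arr s 13 t =
     bridge_node sig (arr s 1) (reg s 19) (reg s 20) y z (t / m) (t mod m)) ->
  (forall t, t < m * m -> arr s 11 (reg s 26 + t) = Nat.b2n (asb (inner_break D y (t / m) (t mod m)))) ->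
  (forall t, t < m * m -> arr s 11 (reg s 27 + t) = Nat.b2n (asb (inner_break D z (t / m) (t mod m)))) ->
  reg s 23 + m * m <= reg s 26 \/ reg s 26 + m * m <= reg s 23 ->
  reg s 23 + m * m <= reg s 27 \/ reg s 27 + m * m <= reg s 23 ->
  0 < m -> 1 + 2 * (m * m) < 2 ^ W -> reg s 23 + m * m < 2 ^ W ->
  reg s 26 + m * m < 2 ^ W -> reg s 27 + m * m < 2 ^ W ->
  (forall s', (forall x, x <= 98 -> reg s' x = reg s x) ->
     (forall a i, a <= 98 -> a <> 11 -> arr s' a i = arr s a i) ->
     (forall i, i < reg s 23 \/ reg s 23 + m * m <= i -> arr s' 11 i = arr s 11 i) ->
     (forall t, t < m * m -> arr s' 11 (reg s 23 + t) =
        Nat.b2n (asb (inner_break D (y ++ z) (t / m) (t mod m)))) ->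
     Q s') ->
  runs W (pair_product mm) s (100 + m * m * 150 + 2 * N) Q.
Proof.
  intros Hmm HT Hy Hz HD Rm Rmm R29 R31 Hla Hlb Hnodes Hmy Hmz Dis1 Dis2 Hm HB HB23 HB26 HB27 HQ.
  set (la := reg s 19) in *. set (lb := reg s 20) in *.
  eapply runs_le.
  { unfold pair_product.
    eapply runs_seq. eapply (runs_fill W _ _ _ _ 1 (m * m)
      (fun t => Nat.b2n (asb (bridge D y z (t / m) (t mod m))))); sim; try lia.
    { intros t Ht. cbv zeta. sim. rewrite Rm.
      destruct (div_mod_square m t Ht) as (Hp & Hq & _).
      split; [split_fits|]. rewrite Hnodes by auto.
      set (p := t / m) in *. set (q := t mod m) in *. decide_conds.
      - rewrite (proj2 (asb_true _)); auto. left. auto.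
      - rewrite (proj2 (asb_false _)); auto. intros [?|?]; lia.
      - rewrite (proj2 (asb_false _)); auto. intros [?|?]; lia.
      - rewrite Hla, Hlb. apply (bridge_final _ _ _ _ _ _ _ _ _ _ HT); auto; lia. }
    eapply runs_seq. eapply (runs_fill W _ _ _ _ (1 + m * m) (m * m)
      (fun t => Nat.b2n (asb (inner_break D z (t / m) (t mod m))))); sim; try lia.
    { intros t Ht. cbv zeta. sim. split; [split_fits|]. now apply Hmz. }
    eapply runs_seq. apply runs_store; sim; [lia|lia|].
    eapply runs_seq. apply runs_assign; sim; [lia|lia|].
    eapply runs_seq. apply (Hmm (fun i j => asb (bridge D y z i j))
      (fun i j => asb (inner_break D z i j))); sim; try lia.
    { intros t Ht. rewrite upd_neq, block_out by lia. now rewrite (block_in _ 1). }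
    { intros t Ht. rewrite upd_neq by lia. now rewrite (block_in _ (1 + m * m)). }
    intros s1 Hr1 Ha1 Hp1.
    assert (E4 : reg s1 4 = m) by (rewrite Hr1 by lia; exact Rm).
    assert (E23 : reg s1 23 = reg s 23) by now rewrite Hr1 by lia.
    assert (E26 : reg s1 26 = reg s 26) by now rewrite Hr1 by lia.
    assert (E27 : reg s1 27 = reg s 27) by now rewrite Hr1 by lia.
    assert (E30 : reg s1 30 = m * m) by (rewrite Hr1 by lia; exact Rmm).
    assert (E31 : reg s1 31 = 1 + m * m) by (rewrite Hr1 by lia; exact R31).
    assert (E29 : reg s1 29 = 1) by (rewrite Hr1 by lia; exact R29).
    assert (E11 : forall i, arr s1 11 i = arr s 11 i) by (intros i; now rewrite Ha1 by lia).
    set (P := fun i j => bool_mul m (fun i j => asb (bridge D y z i j))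
                (fun i j => asb (inner_break D z i j)) i j) in *.
    eapply runs_seq. eapply (runs_fill W _ _ _ _ (1 + m * m) (m * m)
      (fun t => Nat.b2n (P (t / m) (t mod m)))); sim; try lia.
    { intros t Ht. cbv zeta. sim. split; [lia|]. rewrite block_out by lia. now apply Hp1. }
    eapply runs_seq. eapply (runs_fill W _ _ _ _ 1 (m * m)
      (fun t => Nat.b2n (asb (inner_break D y (t / m) (t mod m))))); sim; try lia.
    { intros t Ht. cbv zeta. sim. rewrite E26, E11. split; [split_fits|]. now apply Hmy. }
    eapply runs_seq. apply runs_store; sim; [lia|lia|].
    eapply runs_seq. apply runs_assign; sim; [lia|lia|].
    eapply runs_seq. apply (Hmm (fun i j => asb (inner_break D y i j)) P); sim; try lia.
    { intros t Ht. rewrite upd_neq by lia. now rewrite (block_in _ 1). }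
    { intros t Ht. rewrite upd_neq, block_out by lia. now rewrite (block_in _ (1 + m * m)). }
    intros s2 Hr2 Ha2 Hp2.
    assert (F4 : reg s2 4 = m) by (rewrite Hr2 by lia; sim; exact E4).
    assert (F19 : reg s2 19 = la) by (rewrite Hr2 by lia; sim; now rewrite Hr1 by lia).
    assert (F20 : reg s2 20 = lb) by (rewrite Hr2 by lia; sim; now rewrite Hr1 by lia).
    assert (F23 : reg s2 23 = reg s 23) by (rewrite Hr2 by lia; sim; exact E23).
    assert (F26 : reg s2 26 = reg s 26) by (rewrite Hr2 by lia; sim; exact E26).
    assert (F27 : reg s2 27 = reg s 27) by (rewrite Hr2 by lia; sim; exact E27).
    assert (F30 : reg s2 30 = m * m) by (rewrite Hr2 by lia; sim; exact E30).
    assert (F11 : forall i, arr s2 11 i = arr s 11 i) by (intros i; rewrite Ha2 by lia; sim; apply E11).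
    eapply (runs_fill W _ _ _ _ (reg s 23) (m * m)
      (fun t => Nat.b2n (asb (inner_break D (y ++ z) (t / m) (t mod m))))); sim; try lia.
    { intros t Ht. cbv zeta. sim. rewrite F4, F19, F20, F26, F27.
      destruct (div_mod_square m t Ht) as (Hp & Hq & Et).
      set (p := t / m) in *. set (q := t mod m) in *.
      split.
      - split_fits; nia.
      - decide_conds.
        + assert ((p - la) * m <= p * m) by (apply Nat.mul_le_mono_r; lia).
          assert ((p - la) * m + q < m * m) by lia.
          rewrite block_out, F11, Hmz by (try apply (ranges_disjoint (m * m)); auto).
          destruct (div_mod_pair m (p - la) q Hq) as [-> ->].
          f_equal. apply asb_iff. rewrite inner_break_app_right by lia.
          (* Since [la < p < m], the length of [y] was not cut off. *)
          replace (length y) with la by lia. reflexivity.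
        + assert (p * m + (q - lb) < m * m) by lia.
          rewrite block_out, F11, Hmy by (try apply (ranges_disjoint (m * m)); auto).
          destruct (div_mod_pair m p (q - lb)) as [-> ->]; [lia|].
          f_equal. apply asb_iff. rewrite inner_break_app_left by lia.
          replace (length z) with lb by lia. reflexivity.
        + rewrite Hp2 by auto. f_equal. fold p q. apply eq_true_iff_eq.
          rewrite asb_true, (inner_break_app D m) by (auto; lia).
          rewrite bool_mul_true. unfold P. split.
          * intros (k & Hk & H1 & H2). apply (proj1 (asb_true _)) in H1.
            apply bool_mul_true in H2 as (l & Hl & H2 & H3). apply (proj1 (asb_true _)) in H2, H3.
            exists k, l. auto.
          * intros (k & l & Hk & Hl & H1 & H2 & H3). exists k. rewrite asb_true. split; [auto|].
            split; [auto|]. apply bool_mul_true. exists l. rewrite !asb_true. auto. }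
    apply HQ; sim.
    - intros x Hx. rewrite upd_neq, Hr2 by lia. sim. rewrite !upd_neq, Hr1 by lia. sim.
      now rewrite !upd_neq by lia.
    - intros a i Ha Hne. rewrite upd_neq, Ha2 by lia. sim. rewrite !upd_neq, Ha1 by lia. sim.
      now rewrite !upd_neq by lia.
    - intros i Hi. rewrite block_out by lia. apply F11.
    - intros t Ht. now rewrite (block_in _ (reg s 23)). }
  sim. nia.
Qed.

(** The summary of [x]: the rows of two strings determine the row of their concatenation. *)
Definition row (D : list (list nat)) (m : nat) (s : state) (u : nat) (x : list nat) : Prop :=
  arr s 8 u = min (length x) m /\
  (forall k, k < min (length x) m -> arr s 9 (u * m + k) = nth k x 0) /\
  (forall k, k < min (length x) m -> arr s 10 (u * m + k) = nth k (rev x) 0) /\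
  (forall t, t < m * m ->
     arr s 11 (u * (m * m) + t) = Nat.b2n (asb (inner_break D x (t / m) (t mod m)))).

Definition ready (sig m : nat) (D : list (list nat)) (s : state) : Prop :=
  reg s 1 = sig /\ reg s 4 = m /\ reg s 30 = m * m /\
  trie sig (arr s 1) (arr s 2) (reg s 5) D.

Lemma rows_disjoint (n u v k : nat) : u <> v -> k < n ->
  u * n + k < v * n \/ v * n + n <= u * n + k.
Proof. intros Hne Hk. assert (u < v \/ v < u) as [H|H] by lia; [left|right]; nia. Qed.

Lemma row_keep (D : list (list nat)) (m : nat) (s s' : state) (v u : nat) (x : list nat) :
  u <> v ->
  (forall i, i <> v -> arr s' 8 i = arr s 8 i) ->
  (forall a i, a = 9 \/ a = 10 -> i < v * m \/ v * m + m <= i -> arr s' a i = arr s a i) ->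
  (forall i, i < v * (m * m) \/ v * (m * m) + m * m <= i -> arr s' 11 i = arr s 11 i) ->
  row D m s u x -> row D m s' u x.
Proof.
  intros Hne H8 H9 H11 (R8 & R9 & R10 & R11). split; [|split; [|split]].
  - now rewrite H8.
  - intros k Hk. rewrite H9; auto. apply rows_disjoint; lia.
  - intros k Hk. rewrite H9; auto. apply rows_disjoint; lia.
  - intros t Ht. rewrite H11; auto. now apply rows_disjoint.
Qed.

(** Cut-off lengths locate the letter correctly: if [y] has at least [m] letters, then [k < m] stays
    inside [y]. The reversed suffixes use this with the two strings exchanged. *)
Lemma nth_app_cut (m k : nat) (y z : list nat) :
  k < min (length (y ++ z)) m ->
  nth k (y ++ z) 0 = if k <? min (length y) m then nth k y 0 else nth (k - min (length y) m) z 0.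
Proof.
  rewrite length_app. intros Hk. destruct (Nat.ltb_spec k (min (length y) m)).
  - apply app_nth1. lia.
  - rewrite app_nth2 by lia. f_equal. lia.
Qed.

(** For one letter, [i + j = 1] leaves the empty string, and only the entry [(0, 0)] depends on the
    dictionary. It is the mark of the child of the root, whose cell is [1 * sig + a]. *)
Definition eval_leaf : prog :=
  assign 22 (EMul (Var 15) (Var 4));;
  assign 23 (EMul (Var 15) (Var 30));;
  store 8 (Var 15) (Num 1);;
  store 9 (Var 22) (Var 17);;
  store 10 (Var 22) (Var 17);;
  fill 11 23 30 (EEq (EAdd row_index col_index) (Num 1));;
  store 11 (Var 23) (Cell 2 (Cell 1 (EAdd (Var 1) (Var 17)))).

Definition eval_pair (mm : prog) : prog :=
  assign 19 (Cell 8 (Var 17));;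
  assign 20 (Cell 8 (Var 18));;
  assign 22 (EMul (Var 15) (Var 4));;
  assign 23 (EMul (Var 15) (Var 30));;
  assign 24 (EMul (Var 17) (Var 4));;
  assign 25 (EMul (Var 18) (Var 4));;
  assign 26 (EMul (Var 17) (Var 30));;
  assign 27 (EMul (Var 18) (Var 30));;
  assign 28 (Num 0);;
  assign 29 (Num 1);;
  assign 31 (EAdd (Num 1) (Var 30));;
  store 8 (Var 15) (Cond (ELt (EAdd (Var 19) (Var 20)) (Var 4)) (EAdd (Var 19) (Var 20)) (Var 4));;
  fill 9 22 4 (Cond (ELt (Var 99) (Var 19)) (Cell 9 (EAdd (Var 24) (Var 99)))
                 (Cell 9 (EAdd (Var 25) (ESub (Var 99) (Var 19)))));;
  fill 10 22 4 (Cond (ELt (Var 99) (Var 20)) (Cell 10 (EAdd (Var 25) (Var 99)))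
                  (Cell 10 (EAdd (Var 24) (ESub (Var 99) (Var 20)))));;
  (suffix_nodes;; bridge_nodes);;
  pair_product mm.

Lemma mul_le_square (u m : nat) : u * m <= u * (m * m).
Proof. apply Nat.mul_le_mono_l. destruct m; simpl; lia. Qed.

Lemma row_bound (n u k : nat) : u < k -> u * n + n <= k * n.
Proof. nia. Qed.

Lemma runs_eval_leaf (W sig m nv v a : nat) (D : list (list nat)) (s : state) (Q : state -> Prop) :
  ready sig m D s -> reg s 15 = v -> reg s 17 = a -> a < sig -> v < nv ->
  0 < m -> (nv + 2) * (m * m) + 2 < 2 ^ W -> reg s 5 * sig < 2 ^ W ->
  (forall s', (forall x, x <= 18 -> reg s' x = reg s x) -> reg s' 30 = reg s 30 ->
     (forall b i, b <= 7 -> arr s' b i = arr s b i) ->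
     row D m s' v [a] ->
     (forall u x, u <> v -> row D m s u x -> row D m s' u x) -> Q s') ->
  runs W eval_leaf s (60 + m * m * 30) Q.
Proof.
  intros (R1 & R4 & R30 & HT) R15 R17 Ha Hv Hm HB HBn HQ.
  pose proof (row_bound (m * m) v nv Hv) as Hrow.
  pose proof (mul_le_square v m) as Hvm.
  pose proof (mul_le_square 1 m) as Hmm. rewrite !Nat.mul_1_l in Hmm.
  assert (Hnn := trie_size _ _ _ _ _ HT).
  assert (Hsa : sig + a < 2 ^ W) by nia.
  eapply runs_le.
  { unfold eval_leaf.
    eapply runs_seq. apply runs_assign; sim; [lia|lia|]. rewrite R15, R4.
    eapply runs_seq. apply runs_assign; sim; [lia|lia|]. rewrite R15, R30.
    eapply runs_seq. apply runs_store; sim; [lia|lia|]. rewrite R15.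
    eapply runs_seq. apply runs_store; sim; [lia|lia|]. rewrite R17.
    eapply runs_seq. apply runs_store; sim; [lia|lia|]. rewrite R17.
    eapply runs_seq. eapply (runs_fill W _ _ _ _ (v * (m * m)) (m * m)
      (fun t => Nat.b2n (t / m + t mod m =? 1))); sim; try lia.
    { intros t Ht. cbv zeta. sim. rewrite R4.
      destruct (div_mod_square m t Ht) as (Hp & Hq & Et).
      split; [split_fits; nia|reflexivity]. }
    apply runs_store; sim; [lia|lia|]. rewrite R1, R17.
    apply HQ; sim; auto.
    - intros x Hx. now rewrite !upd_neq by lia.
    - intros b i Hb. now rewrite !upd_neq by lia.
    - split; [|split; [|split]]; sim.
      + rewrite upd_eq. cbn [length]. lia.
      + cbn [length]. intros k Hk. replace k with 0 by lia. now rewrite Nat.add_0_r, upd_eq.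
      + cbn [length]. intros k Hk. replace k with 0 by lia. now rewrite Nat.add_0_r, upd_eq.
      + intros t Ht. destruct (div_mod_square m t Ht) as (Hp & Hq & Et).
        destruct (Nat.eq_dec t 0) as [->|Hne].
        * rewrite Nat.add_0_r, upd_eq.
          assert (Hw : letters sig [a]) by (constructor; auto).
          pose proof (trie_final _ _ _ _ _ HT [a] Hw) as Hf.
          unfold walk in Hf. simpl in Hf. rewrite Nat.add_0_r in Hf. rewrite Hf. f_equal.
          apply asb_iff. rewrite inner_break_single, Nat.Div0.div_0_l, Nat.Div0.mod_0_l.
          split; auto. intros [?|(_ & _ & ?)]; [lia|auto].
        * rewrite upd_neq, block_in by lia. f_equal. apply eq_true_iff_eq.
          rewrite asb_true, inner_break_single, Nat.eqb_eq. split; auto.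
          intros [?|(H1 & H2 & _)]; [auto|]. rewrite H1, H2 in Et. simpl in Et. lia.
    - intros u x Hu. apply (row_keep _ _ _ _ v); auto; sim.
      + intros i Hi. now rewrite upd_neq.
      + intros b i [->| ->] Hi; sim; rewrite upd_neq; auto; lia.
      + intros i Hi. rewrite upd_neq, block_out by lia. auto. }
  sim. nia.
Qed.

Lemma runs_eval_pair (mm : prog) (W sig m nv v a b N : nat) (D : list (list nat)) (y z : list nat)
    (s : state) (Q : state -> Prop) :
  multiplies mm W m N -> Forall (fun d => length d <= m) D ->
  ready sig m D s -> reg s 15 = v -> reg s 17 = a -> reg s 18 = b ->
  v < nv -> a < nv -> b < nv -> v <> a -> v <> b ->
  letters sig y -> letters sig z -> row D m s a y -> row D m s b z ->
  0 < m -> (nv + 2) * (m * m) + 2 < 2 ^ W -> reg s 5 * sig < 2 ^ W ->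
  (forall s', (forall x, x <= 18 -> reg s' x = reg s x) -> reg s' 30 = reg s 30 ->
     (forall b i, b <= 7 -> arr s' b i = arr s b i) ->
     row D m s' v (y ++ z) ->
     (forall u x, u <> v -> row D m s u x -> row D m s' u x) -> Q s') ->
  runs W (eval_pair mm) s (250 + m * m * 360 + 2 * N) Q.
Proof.
  intros Hmul HD (R1 & R4 & R30 & HT) R15 R17 R18 Hv Ha Hb Hva Hvb Hy Hz
    (Y8 & Y9 & Y10 & Y11) (Z8 & Z9 & Z10 & Z11) Hm HB HBn HQ.
  pose proof (row_bound (m * m) v nv Hv) as Hrow.
  pose proof (row_bound (m * m) a nv Ha) as Harow.
  pose proof (row_bound (m * m) b nv Hb) as Hbrow.
  pose proof (mul_le_square v m) as Hvm.
  pose proof (mul_le_square a m) as Ham.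
  pose proof (mul_le_square b m) as Hbm.
  pose proof (mul_le_square 1 m) as Hmm. rewrite !Nat.mul_1_l in Hmm.
  set (la := min (length y) m) in *. set (lb := min (length z) m) in *.
  eapply runs_le.
  { unfold eval_pair.
    eapply runs_seq. apply runs_assign; sim; [lia|lia|]. rewrite R17, Y8.
    eapply runs_seq. apply runs_assign; sim; [lia|lia|]. rewrite R18, Z8.
    eapply runs_seq. apply runs_assign; sim; [lia|lia|]. rewrite R15, R4.
    eapply runs_seq. apply runs_assign; sim; [lia|lia|]. rewrite R15, R30.
    eapply runs_seq. apply runs_assign; sim; [lia|lia|]. rewrite R17, R4.
    eapply runs_seq. apply runs_assign; sim; [lia|lia|]. rewrite R18, R4.
    eapply runs_seq. apply runs_assign; sim; [lia|lia|]. rewrite R17, R30.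
    eapply runs_seq. apply runs_assign; sim; [lia|lia|]. rewrite R18, R30.
    do 3 (eapply runs_seq; apply runs_assign; sim; [lia|lia|]).
    eapply runs_seq. apply runs_store; sim; [lia|split_fits|].
    rewrite R15, R4.
    eapply runs_seq. eapply (runs_fill W _ _ _ _ (v * m) m
      (fun k => if k <? la then arr s 9 (a * m + k) else arr s 9 (b * m + (k - la)))); sim; try lia.
    { intros k Hk. cbv zeta. sim. split; [split_fits|].
      decide_conds; apply block_out;
        [pose proof (rows_disjoint m a v k)|pose proof (rows_disjoint m b v (k - la))]; lia. }
    eapply runs_seq. eapply (runs_fill W _ _ _ _ (v * m) m
      (fun k => if k <? lb then arr s 10 (b * m + k) else arr s 10 (a * m + (k - lb)))); sim; try lia.
    { intros k Hk. cbv zeta. sim. split; [split_fits|].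
      decide_conds; apply block_out;
        [pose proof (rows_disjoint m b v k)|pose proof (rows_disjoint m a v (k - lb))]; lia. }
    eapply runs_seq. apply (runs_nodes W sig m D y z); sim; auto; try lia.
    { intros k Hk. rewrite block_out; auto. apply rows_disjoint; auto. lia. }
    { intros k Hk. rewrite block_out; auto. apply rows_disjoint; auto. lia. }
    intros s1 Hr1 Ha1 Hn1.
    (* [trie] speaks of whole arrays, so cellwise equality has to become equality of functions. *)
    assert (E1 : arr s1 1 = arr s 1) by (extensionality i; now rewrite Ha1 by lia).
    assert (E2 : arr s1 2 = arr s 2) by (extensionality i; now rewrite Ha1 by lia).
    assert (E11 : forall i, arr s1 11 i = arr s 11 i) by (intros i; now rewrite Ha1 by lia).
    apply (runs_pair_product mm W sig m N D y z); auto; rewrite ?Hr1 by lia; sim;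
      rewrite ?E1, ?E2; auto; try lia.
    { intros t Ht. rewrite E11. now apply Y11. }
    { intros t Ht. rewrite E11. now apply Z11. }
    { assert (v < a \/ a < v) as [H|H] by lia; [left|right]; now apply row_bound. }
    { assert (v < b \/ b < v) as [H|H] by lia; [left|right]; now apply row_bound. }
    intros s2 Hr2 Ha2 Hout Hin.
    apply HQ.
    - intros x Hx. rewrite Hr2, Hr1 by lia. sim. now rewrite !upd_neq by lia.
    - rewrite Hr2, Hr1 by lia. reflexivity.
    - intros c i Hc. rewrite Ha2, Ha1 by lia. sim. now rewrite !upd_neq by lia.
    - split; [|split; [|split]].
      + rewrite Ha2, Ha1 by lia. sim. rewrite upd_eq, length_app. decide_conds; lia.
      + intros k Hk. rewrite Ha2, Ha1 by lia. sim. rewrite block_in by lia.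
        rewrite (nth_app_cut m) by auto. fold la. rewrite length_app in Hk.
        destruct (Nat.ltb_spec k la); [apply Y9; lia|apply Z9; lia].
      + intros k Hk. rewrite Ha2, Ha1 by lia. sim. rewrite block_in by lia.
        rewrite rev_app_distr, (nth_app_cut m)
          by (rewrite length_app, !length_rev; rewrite length_app in Hk; lia).
        rewrite length_rev. fold lb. rewrite length_app in Hk.
        destruct (Nat.ltb_spec k lb); [apply Z10; lia|apply Y10; lia].
      + exact Hin.
    - intros u x Hu. apply (row_keep _ _ _ _ v); auto.
      + intros i Hi. rewrite Ha2, Ha1 by lia. sim. now rewrite upd_neq.
      + intros c i [->| ->] Hi; rewrite Ha2, Ha1 by lia; sim; now rewrite block_out.
      + intros i Hi. now rewrite Hout, E11 by auto. }
  sim. lia.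
Qed.

(** * Evaluating all nonterminals *)

(* Array 7 is the stack of a depth-first search, register 16 its height. *)

Definition pop : prog :=
  store 6 (Var 15) (Num 1);;
  assign 16 (ESub (Var 16) (Num 1)).

Definition push (x : nat) : prog :=
  store 7 (Var 16) (Var x);;
  assign 16 (EAdd (Var 16) (Num 1)).

(** The top of the stack stays there until both children are evaluated; a visit pushes at most one
    child. *)
Definition visit (mm : prog) : prog :=
  assign 15 (Cell 7 (ESub (Var 16) (Num 1)));;
  assign 17 (Cell 4 (Var 15));;
  cond (Cell 3 (Var 15))
    (assign 18 (Cell 5 (Var 15));;
     cond (Cell 6 (Var 17))
       (cond (Cell 6 (Var 18)) (eval_pair mm;; pop) (push 18))
       (push 17))
    (eval_leaf;; pop).

Definition evaluate (mm : prog) : prog :=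
  assign 30 (EMul (Var 4) (Var 4));;
  store 7 (Num 0) (Var 13);;
  assign 16 (Num 1);;
  loop (Var 16) (visit mm).

(** A strict order that decreases from a nonterminal to its children, since expansions are nonempty.
    A stack sorted by it has no repetitions. *)
Definition shorter (G : cfg) (u v : nat) : Prop :=
  length (expansion G u) < length (expansion G v).

(* Every visit lowers [2 * undone G s - length stk] by one: it either pushes an
   open nonterminal or closes the top one. *)
Record searching (G : cfg) (sig m nn : nat) (D : list (list nat)) (s : state)
    (stk : list nat) : Prop := {
  sr_ready : ready sig m D s;
  sr_nodes : reg s 5 = nn;
  sr_rules : forall v, v < nvar G -> stored s v (rhs G v);
  sr_done : forall v, v < nvar G ->
    arr s 6 v = 0 \/ (arr s 6 v = 1 /\ row D m s v (expansion G v));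
  sr_start : reg s 13 = start G;
  sr_height : reg s 16 = length stk;
  sr_stack : forall i, i < length stk -> arr s 7 i = nth i (rev stk) 0;
  sr_open : Forall (fun v => v < nvar G /\ arr s 6 v = 0) stk;
  sr_sorted : StronglySorted (shorter G) stk;
  sr_goal : In (start G) stk \/ arr s 6 (start G) = 1
}.

Definition undone (G : cfg) (s : state) : nat :=
  length (filter (fun v => arr s 6 v =? 0) (seq 0 (nvar G))).

Lemma sorted_NoDup (G : cfg) (stk : list nat) : StronglySorted (shorter G) stk -> NoDup stk.
Proof.
  induction 1 as [|v stk _ IH Hv]; constructor; auto.
  intros Hin. apply (proj1 (Forall_forall _ _) Hv) in Hin. unfold shorter in Hin. lia.
Qed.

(** The stacked nonterminals are distinct and open. This bounds the height of the stack and keeps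
    the truncated subtraction in the potential exact. *)
Lemma stack_le_undone (G : cfg) (sig m nn : nat) (D : list (list nat)) (s : state) (stk : list nat) :
  searching G sig m nn D s stk -> length stk <= undone G s.
Proof.
  intros H. apply NoDup_incl_length; [eapply sorted_NoDup, sr_sorted; eauto|].
  intros v Hv. apply (proj1 (Forall_forall _ _) (sr_open _ _ _ _ _ _ _ H)) in Hv as [Hv H0].
  apply filter_In. rewrite H0, in_seq. split; [lia|auto].
Qed.

Lemma undone_le (G : cfg) (s : state) : undone G s <= nvar G.
Proof. unfold undone. rewrite <- (length_seq (nvar G) 0) at 2. apply filter_length_le. Qed.

Lemma undone_mark (G : cfg) (s s' : state) (v : nat) :
  v < nvar G -> arr s 6 v = 0 -> (forall u, arr s' 6 u = upd (arr s 6) v 1 u) ->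
  undone G s' + 1 = undone G s.
Proof.
  intros Hv H0 Hs. unfold undone.
  (* Stated for every duplicate-free list, so that the count goes by induction. *)
  assert (H : forall l, NoDup l -> length (filter (fun u => arr s' 6 u =? 0) l) +
      (if in_dec Nat.eq_dec v l then 1 else 0) = length (filter (fun u => arr s 6 u =? 0) l)).
  { induction 1 as [|u l Hu _ IH]; [auto|]. cbn [filter]. rewrite Hs.
    destruct (Nat.eq_dec u v) as [->|Hne].
    - rewrite upd_eq, H0. cbn [Nat.eqb length].
      destruct (in_dec Nat.eq_dec v l); [contradiction|].
      destruct (in_dec Nat.eq_dec v (v :: l)) as [|n']; [lia|]. destruct n'. now left.
    - rewrite upd_neq by auto.
      destruct (in_dec Nat.eq_dec v l) as [i|i], (in_dec Nat.eq_dec v (u :: l)) as [j|j];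
        try (destruct j; now right); try (destruct j as [j|j]; congruence);
        destruct (arr s 6 u =? 0); cbn [length]; lia. }
  rewrite <- (H (seq 0 (nvar G))) by apply seq_NoDup.
  destruct (in_dec Nat.eq_dec v (seq 0 (nvar G))) as [|n']; [auto|].
  destruct n'. apply in_seq. lia.
Qed.

Lemma stored_ext (s s' : state) (v : nat) (alpha : list symbol) :
  (forall a i, 3 <= a <= 5 -> arr s' a i = arr s a i) -> stored s v alpha -> stored s' v alpha.
Proof.
  intros H. unfold stored. now rewrite !H by lia.
Qed.

Lemma runs_push (W : nat) (G : cfg) (sig m nn v x y : nat) (D : list (list nat)) (rest : list nat)
    (s : state) (Q : state -> Prop) :
  searching G sig m nn D s (v :: rest) -> 16 < x <= 18 -> reg s x = y ->
  y < nvar G -> arr s 6 y = 0 -> shorter G y v -> nvar G + 1 < 2 ^ W ->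
  (forall s', searching G sig m nn D s' (y :: v :: rest) -> undone G s' = undone G s -> Q s') ->
  runs W (push x) s 8 Q.
Proof.
  intros HS Hx Hy Hyn Hy0 Hyv HB HQ.
  pose proof (stack_le_undone _ _ _ _ _ _ _ HS) as Hle. pose proof (undone_le G s) as Hle'.
  destruct HS as [(H1 & H4 & H30 & HT) Hnn Hrul Hdone Hst Hh Hstk Hop Hso Hgo].
  unfold push. eapply runs_le.
  { eapply runs_seq. apply runs_store; sim; [lia|lia|].
    apply runs_assign; sim; [lia|lia|].
    rewrite Hh, Hy. apply HQ; [|reflexivity]. split; sim; auto.
    - split; auto.
    - simpl. lia.
    - intros i Hi. change (rev (y :: v :: rest)) with (rev (v :: rest) ++ [y]).
      destruct (Nat.eq_dec i (length (v :: rest))) as [->|Hne].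
      + rewrite upd_eq, app_nth2, length_rev, Nat.sub_diag; auto. rewrite length_rev. lia.
      + rewrite upd_neq, app_nth1; auto; [apply Hstk|rewrite length_rev]; cbn [length] in *; lia.
    - constructor; auto. inversion Hso as [|? ? Hs' Hf]. constructor; auto.
      eapply Forall_impl; [|exact Hf]. unfold shorter in *. intros u Hu. lia.
    - simpl. simpl in Hgo. tauto. }
  sim. lia.
Qed.

Lemma runs_pop (W : nat) (G : cfg) (sig m nn v : nat) (D : list (list nat)) (rest : list nat)
    (s : state) (Q : state -> Prop) :
  searching G sig m nn D s (v :: rest) -> reg s 15 = v -> row D m s v (expansion G v) -> 0 < W ->
  (forall s', searching G sig m nn D s' rest -> undone G s' + 1 = undone G s -> Q s') ->
  runs W pop s 8 Q.
Proof.
  intros [(H1 & H4 & H30 & HT) Hnn Hrul Hdone Hst Hh Hstk Hop Hso Hgo] H15 Hrow HW HQ.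
  pose proof (pow2_gt1 W HW) as HB.
  inversion Hop as [|? ? [Hv Hv0] Hop']. inversion Hso as [|? ? Hso' Hlt]. subst.
  cbn [length] in *.
  unfold pop. eapply runs_le.
  { eapply runs_seq. apply runs_store; sim; [lia|lia|].
    apply runs_assign; sim; [lia|lia|].
    apply HQ.
    - split; sim; auto.
      + split; auto.
      + intros u Hu. destruct (Nat.eq_dec u (reg s 15)) as [->|Hne].
        * right. rewrite upd_eq. auto.
        * rewrite upd_neq by auto. auto.
      + lia.
      + intros i Hi. rewrite Hstk by lia. simpl. now rewrite app_nth1 by now rewrite length_rev.
      + apply Forall_forall. intros u Hu.
        pose proof (proj1 (Forall_forall _ _) Hop' u Hu) as [Hun Hu0].
        pose proof (proj1 (Forall_forall _ _) Hlt u Hu) as Hul.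
        split; auto. rewrite upd_neq; auto. intros ->. unfold shorter in Hul. lia.
      + destruct (Nat.eq_dec (start G) (reg s 15)) as [->|Hne].
        * right. apply upd_eq.
        * rewrite upd_neq by auto. destruct Hgo as [[Hgo|Hgo]|Hgo]; auto. congruence.
    - eapply undone_mark; eauto. }
  sim. lia.
Qed.

Lemma searching_ext (G : cfg) (sig m nn : nat) (D : list (list nat)) (s s' : state) (stk : list nat) :
  (forall x, In x [1; 4; 5; 13; 16; 30] -> reg s' x = reg s x) ->
  (forall a i, a <= 7 -> arr s' a i = arr s a i) ->
  (forall u x, u < nvar G -> arr s 6 u = 1 -> row D m s u x -> row D m s' u x) ->
  searching G sig m nn D s stk -> searching G sig m nn D s' stk.
Proof.
  intros Hr Ha Hrow [(H1 & H4 & H30 & HT) Hnn Hrul Hdone Hst Hh Hstk Hop Hso Hgo].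
  assert (E1 : arr s' 1 = arr s 1) by (extensionality i; apply Ha; lia).
  assert (E2 : arr s' 2 = arr s 2) by (extensionality i; apply Ha; lia).
  split; auto; rewrite ?Hr by (simpl; auto 10); auto.
  - unfold ready. rewrite (Hr 1), (Hr 4), (Hr 30), (Hr 5), E1, E2 by (simpl; auto 10). auto.
  - intros v Hv. apply (stored_ext s); auto. intros a i Hi. apply Ha. lia.
  - intros v Hv. rewrite Ha by lia. destruct (Hdone v Hv) as [H|[H H']]; auto.
  - intros i Hi. rewrite Ha by lia. auto.
  - eapply Forall_impl; [|exact Hop]. intros u Hu. now rewrite Ha by lia.
  - now rewrite Ha by lia.
Qed.

Lemma undone_ext (G : cfg) (s s' : state) :
  (forall i, arr s' 6 i = arr s 6 i) -> undone G s' = undone G s.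
Proof.
  intros H. unfold undone. f_equal. apply filter_ext. intros u. now rewrite H.
Qed.

Lemma runs_visit (mm : prog) (W : nat) (G : cfg) (m nn N v : nat) (D : list (list nat))
    (rest : list nat) (s : state) :
  multiplies mm W m N -> Forall (fun d => length d <= m) D -> is_slp G ->
  searching G (nsig G) m nn D s (v :: rest) ->
  0 < m -> (nvar G + 2) * (m * m) + 2 < 2 ^ W -> nn * nsig G < 2 ^ W ->
  runs W (visit mm) s (300 + m * m * 360 + 2 * N) (fun s' => exists stk,
    searching G (nsig G) m nn D s' stk /\
    2 * undone G s' - length stk < 2 * undone G s - length (v :: rest)).
Proof.
  intros Hmul HD HG HS Hm HB HBn.
  pose proof (stack_le_undone _ _ _ _ _ _ _ HS) as Hle. pose proof (undone_le G s) as Hle'.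
  assert (HBv : nvar G + 2 < 2 ^ W) by nia.
  assert (HW : 0 < W) by (destruct W; [simpl in HBv; lia|lia]).
  pose proof (sr_height _ _ _ _ _ _ _ HS) as Hh.
  pose proof (sr_stack _ _ _ _ _ _ _ HS (length rest) ltac:(simpl; lia)) as Htop.
  simpl rev in Htop. rewrite app_nth2, length_rev, Nat.sub_diag in Htop
    by (rewrite length_rev; lia). simpl in Htop.
  pose proof (sr_open _ _ _ _ _ _ _ HS) as Hop. inversion Hop as [|? ? [Hv Hv0] Hop']. subst x l.
  pose proof (sr_rules _ _ _ _ _ _ _ HS v Hv) as Hrul.
  cbn [length] in Hh, Hle.
  set (a := arr s 4 v).
  set (s1 := set_reg (set_reg s 15 v) 17 a).
  assert (HS1 : searching G (nsig G) m nn D s1 (v :: rest)).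
  { apply (searching_ext G _ m nn D s); auto.
    intros x Hx. simpl in Hx. decompose [or] Hx; subst; try reflexivity; contradiction. }
  assert (Hpot : undone G s1 = undone G s) by reflexivity.
  eapply runs_le.
  { unfold visit.
    eapply runs_seq. apply runs_assign; sim; [lia|lia|].
    replace (reg s 16 - 1) with (length rest) by lia. rewrite Htop.
    eapply runs_seq. apply runs_assign; sim; [lia|lia|]. fold a. fold s1.
    apply (runs_cond W _ _ _ _ (282 + m * m * 360 + 2 * N)); [sim; lia| |].
    - change (val s1 (Cell 3 (Var 15))) with (arr s 3 v). intros H3.
      destruct (proj2 HG v Hv) as [(a' & b & Ha & Hb & E)|(a' & Ha & E)];
        rewrite E in Hrul; simpl in Hrul; [|lia].
      destruct Hrul as (_ & Ha' & Hb'). fold a in Ha'. subst a'.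
      pose proof (expansion_pair G v a b HG Hv Ha Hb E) as Ex.
      pose proof (expansion_nonempty G a HG Ha) as La.
      pose proof (expansion_nonempty G b HG Hb) as Lb.
      assert (Lv : length (expansion G v) = length (expansion G a) + length (expansion G b))
        by (rewrite Ex; apply length_app).
      eapply runs_le; [|shelve].
      eapply runs_seq. apply runs_assign; sim; [lia|lia|].
      change (arr s1 5 (reg s1 15)) with (arr s 5 v). rewrite Hb'.
      set (s2 := set_reg s1 18 b).
      assert (HS2 : searching G (nsig G) m nn D s2 (v :: rest)).
      { apply (searching_ext G _ m nn D s1); auto.
        intros x Hx. simpl in Hx. decompose [or] Hx; subst; try reflexivity; contradiction. }
      apply (runs_cond W _ _ _ _ (270 + m * m * 360 + 2 * N)); [sim; lia| |].
      + change (val s2 (Cell 6 (Var 17))) with (arr s 6 a). intros Hda.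
        apply (runs_le W _ _ (cost (Cell 6 (Var 18)) + 1 + (260 + m * m * 360 + 2 * N))); [|sim; lia].
        apply runs_cond; [sim; lia| |].
        * change (val s2 (Cell 6 (Var 18))) with (arr s 6 b). intros Hdb.
          destruct (sr_done _ _ _ _ _ _ _ HS2 a Ha) as [?|[_ Hra]]; [contradiction|].
          destruct (sr_done _ _ _ _ _ _ _ HS2 b Hb) as [?|[_ Hrb]]; [contradiction|].
          eapply runs_le.
          eapply runs_seq.
          apply (runs_eval_pair mm W (nsig G) m (nvar G) v a b N D (expansion G a) (expansion G b));
            auto; try reflexivity.
          { exact (sr_ready _ _ _ _ _ _ _ HS2). }
          (* The expansion of [v] is strictly longer than those of its children, so the row written
             differs from the rows read. *)
          { intros Heq. rewrite Heq in Lv at 1. lia. } { intros Heq. rewrite Heq in Lv at 1. lia. }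
          { now apply expansion_letters. } { now apply expansion_letters. }
          { now rewrite (sr_nodes _ _ _ _ _ _ _ HS2). }
          intros s3 Hr3 H30 Ha3 Hrow3 Hoth3. rewrite <- Ex in Hrow3.
          apply (runs_pop W G (nsig G) m nn v D rest); auto.
          { apply (searching_ext G _ m nn D s2); auto.
            - intros x Hx. simpl in Hx.
              decompose [or] Hx; subst; auto; try (apply Hr3; lia); contradiction.
            (* Only the row of [v] changes, and [v] is not yet flagged as evaluated. *)
            - intros u x Hu Hu1. apply Hoth3. intros ->.
              change (arr s2 6 v) with (arr s 6 v) in Hu1. lia. }
          intros s4 HS4 Hp4. exists rest. split; [auto|].
          assert (undone G s3 = undone G s) by (apply undone_ext; intros i; now rewrite Ha3 by lia).
          cbn [length]. lia. lia.
        * change (val s2 (Cell 6 (Var 18))) with (arr s 6 b). intros Hdb.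
          eapply runs_le.
          apply (runs_push W G (nsig G) m nn v 18 b D rest); auto; try lia.
          { unfold shorter. lia. }
          intros s4 HS4 Hp4. exists (b :: v :: rest). split; [auto|].
          pose proof (stack_le_undone _ _ _ _ _ _ _ HS4).
          change (undone G s2) with (undone G s) in Hp4. cbn [length] in *. lia. lia.
      + change (val s2 (Cell 6 (Var 17))) with (arr s 6 a). intros Hda.
        eapply runs_le.
        apply (runs_push W G (nsig G) m nn v 17 a D rest); auto; try lia.
        { unfold shorter. lia. }
        intros s4 HS4 Hp4. exists (a :: v :: rest). split; [auto|].
        pose proof (stack_le_undone _ _ _ _ _ _ _ HS4).
        change (undone G s2) with (undone G s) in Hp4. cbn [length] in *. lia. lia.
    - change (val s1 (Cell 3 (Var 15))) with (arr s 3 v). intros H3.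
      destruct (proj2 HG v Hv) as [(a' & b & Ha & Hb & E)|(a' & Ha & E)];
        rewrite E in Hrul; simpl in Hrul; [lia|].
      destruct Hrul as (_ & Ha'). fold a in Ha'. subst a'.
      pose proof (expansion_leaf G v a HG Hv E) as Ex.
      eapply runs_le.
      eapply runs_seq.
      apply (runs_eval_leaf W (nsig G) m (nvar G) v a D); auto; try reflexivity.
      { exact (sr_ready _ _ _ _ _ _ _ HS1). }
      { now rewrite (sr_nodes _ _ _ _ _ _ _ HS1). }
      intros s3 Hr3 H30 Ha3 Hrow3 Hoth3. rewrite <- Ex in Hrow3.
      apply (runs_pop W G (nsig G) m nn v D rest); auto.
      { apply (searching_ext G _ m nn D s1); auto.
        - intros x Hx. simpl in Hx.
          decompose [or] Hx; subst; auto; try (apply Hr3; lia); contradiction.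
        - intros u x Hu Hu1. apply Hoth3. intros ->. change (arr s1 6 v) with (arr s 6 v) in Hu1. lia. }
      intros s4 HS4 Hp4. exists rest. split; [auto|].
      assert (undone G s3 = undone G s) by (apply undone_ext; intros i; now rewrite Ha3 by lia).
      cbn [length]. lia. lia. }
  sim. lia.
  Unshelve. sim. lia.
Qed.

(** The potential is at most [2 * nvar G] initially, which bounds the number of visits. When the
    stack is empty, [sr_goal] leaves only the case that the start symbol has been evaluated. *)
Lemma runs_evaluate (mm : prog) (W : nat) (G : cfg) (m nn N : nat) (D : list (list nat))
    (s : state) (Q : state -> Prop) :
  multiplies mm W m N -> Forall (fun d => length d <= m) D -> is_slp G ->
  reg s 1 = nsig G -> reg s 4 = m -> trie (nsig G) (arr s 1) (arr s 2) (reg s 5) D ->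
  reg s 5 = nn -> reg s 13 = start G ->
  (forall v, v < nvar G -> stored s v (rhs G v) /\ arr s 6 v = 0) ->
  0 < m -> (nvar G + 2) * (m * m) + 2 < 2 ^ W -> nn * nsig G < 2 ^ W ->
  (forall s', row D m s' (start G) (expansion G (start G)) ->
     reg s' 13 = start G -> reg s' 30 = m * m -> Q s') ->
  runs W (evaluate mm) s (20 + (302 + m * m * 360 + 2 * N) * (2 * nvar G)) Q.
Proof.
  intros Hmul HD HG H1 H4 HT H5 H13 Hrul Hm HB HBn HQ.
  pose proof HG as [[(Hst & _) _] _].
  assert (Hmm : m * m + 2 < 2 ^ W) by nia.
  eapply runs_le.
  { unfold evaluate.
    eapply runs_seq. apply runs_assign; sim; [lia|lia|]. rewrite H4.
    eapply runs_seq. apply runs_store; sim; [lia|lia|]. rewrite H13.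
    eapply runs_seq. apply runs_assign; sim; [lia|lia|].
    apply (runs_loop W _ _ (fun k s' => exists stk,
      searching G (nsig G) m nn D s' stk /\
      (302 + m * m * 360 + 2 * N) * (2 * undone G s' - length stk) <= k)
      Q) with (k := (302 + m * m * 360 + 2 * N) * (2 * nvar G)).
    2:{ exists [start G]. split.
        - split; sim; auto.
          + split; auto.
          + apply Hrul.
          + intros v Hv. left. now apply Hrul.
          + intros i Hi. simpl in Hi. replace i with 0 by lia. reflexivity.
          + constructor; auto. split; auto. now apply Hrul.
          + constructor; constructor.
          + left. now left.
        - apply Nat.mul_le_mono_l. pose proof (undone_le G s) as H.
          match goal with |- 2 * undone G ?s' - _ <= _ => change (undone G s') with (undone G s) end.
          lia. }
    intros k s' (stk & HS & Hk). sim.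
    rewrite (sr_height _ _ _ _ _ _ _ HS). split; [lia|]. split; intros Hz.
    - destruct stk; [|discriminate].
      destruct (sr_goal _ _ _ _ _ _ _ HS) as [[]|Hd].
      destruct (sr_done _ _ _ _ _ _ _ HS (start G) Hst) as [?|[_ Hrow]]; [congruence|].
      apply HQ; auto; apply HS.
    - destruct stk as [|v rest]; [simpl in Hz; lia|].
      (* The cost of a visit plus 2 for evaluating and testing the guard. *)
      set (T := 302 + m * m * 360 + 2 * N) in *.
      pose proof (stack_le_undone _ _ _ _ _ _ _ HS) as Hle.
      exists (300 + m * m * 360 + 2 * N), (T * (2 * undone G s' - length (v :: rest) - 1)).
      split.
      { cbn [length] in *.
        assert (E : 2 * undone G s' - S (length rest) = S (2 * undone G s' - S (length rest) - 1)) by lia.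
        rewrite E, Nat.mul_succ_r in Hk. unfold T in *. lia. }
      eapply runs_weaken; [apply (runs_visit mm W G m nn N v D rest); auto|lia|].
      intros s2 (stk2 & HS2 & Hp). exists stk2. split; [auto|].
      apply Nat.mul_le_mono_l. lia. }
  sim. lia.
Qed.

(** * The algorithm *)

Definition output (e : expr) : prog :=
  store 0 (Num 0) e;; assign 0 (Num 1).

(* The test is nonzero exactly if some word of the dictionary is nonempty;
   otherwise even reading the grammar would exceed the time bound. *)
Definition solve (mm : prog) : prog :=
  cond (Cond (EEq (Cell 0 (Num 1)) (Num 1)) (Cell 0 (Num 2)) (Cell 0 (Num 1)))
    (build_trie;; load_grammar;; evaluate mm;; output (Cell 11 (EMul (Var 13) (Var 30))))
    (output (Num 0)).

(** * Sizes of the input and dictionaries without nonempty words *)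

Lemma slp_nvar_le_rules (G : cfg) : is_slp G -> nvar G <= length (rules G).
Proof.
  intros HG. rewrite <- (length_map fst), <- (length_seq (nvar G) 0) at 1.
  apply NoDup_incl_length; [apply seq_NoDup|].
  intros v Hv. apply in_seq in Hv. apply in_map_iff. exists (v, rhs G v).
  split; [auto|]. apply slp_rhs_in; auto. lia.
Qed.

Lemma length_encode_dictionary (D : list (list nat)) :
  length (encode_dictionary D) = 1 + length D + total_length D.
Proof.
  unfold encode_dictionary, total_length. cbn [length].
  induction D as [|d D IH]; simpl in *; [auto|]. rewrite length_app. lia.
Qed.

Lemma max_le_total (D : list (list nat)) : max_length D <= total_length D.
Proof.
  unfold max_length, total_length. induction D as [|d D IH]; simpl in *; lia.
Qed.

Lemma max_length_forall (D : list (list nat)) : Forall (fun d => length d <= max_length D) D.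
Proof.
  apply Forall_forall. intros d Hd. unfold max_length.
  pose proof (proj1 (list_max_le (map (@length nat) D) _) (le_n _)) as H.
  apply (proj1 (Forall_forall _ _) H). now apply in_map.
Qed.

(** Distinct words include at most one empty word. This absorbs the number of words, each costing
    constant overhead, into [1 + M]. *)
Lemma length_le_total (D : list (list nat)) : NoDup D -> length D <= 1 + total_length D.
Proof.
  intros HD.
  assert (H : forall E, NoDup E -> length E <= (if in_dec (list_eq_dec Nat.eq_dec) [] E then 1 else 0)
                                  + total_length E).
  { induction 1 as [|d E Hd _ IH]; [simpl; lia|].
    change (total_length (d :: E)) with (length d + total_length E).
    destruct (in_dec _ [] E) as [i|i], (in_dec _ [] (d :: E)) as [j|j]; cbn [length]; try lia.
    - destruct d; [contradiction|cbn [length]; lia].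
    - destruct j. now right.
    - destruct d; [destruct j; now left|cbn [length]; lia]. }
  specialize (H D HD). destruct (in_dec _ _ _); lia.
Qed.

(** With only empty words available, the answer for the string of an SLP is negative, as that string
    is nonempty. *)
Lemma word_break_max0 (D : list (list nat)) (w : list nat) :
  max_length D = 0 -> word_break w D -> w = [].
Proof.
  intros H0 (fs & Hfs & ->). pose proof (max_length_forall D) as Hm. rewrite H0 in Hm.
  induction Hfs as [|f fs Hf _ IH]; [auto|]. simpl. rewrite IH, app_nil_r.
  apply (proj1 (Forall_forall _ _) Hm) in Hf. destruct f; [auto|simpl in Hf; lia].
Qed.

(** Two distinct words cannot both be empty, so a constant-time test decides [m = 0]: only for a
    single word does its length have to be read. *)
Lemma max_length_pos (d d' : list nat) (D : list (list nat)) :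
  NoDup (d :: d' :: D) -> 0 < max_length (d :: d' :: D).
Proof.
  intros H. inversion H as [|? ? Hn _]. subst. unfold max_length. simpl.
  destruct d, d'; cbn [length]; try lia. destruct Hn. now left.
Qed.

Lemma multiplies_relocate (p : prog) (c W m N : nat) (T : R) :
  (forall A B, computes_within p c (m :: row_major m A ++ row_major m B)
     (row_major m (bool_mul m A B)) T) ->
  (forall t, (INR t <= T)%R -> t <= N) ->
  c * (1 + Nat.log2 (2 + 2 * (m * m))) <= W ->
  multiplies (relocate p) W m N.
Proof.
  intros Hp HN HW A B s Q H100 H0 HA HB HQ.
  assert (Hlen : length (m :: row_major m A ++ row_major m B) = 1 + (m * m + m * m))
    by (cbn [length]; rewrite length_app, !length_row_major; auto).
  eapply runs_relocate; [apply Hp|exact HN| | | |].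
  - rewrite Hlen. replace (1 + (1 + (m * m + m * m))) with (2 + 2 * (m * m)) by lia. exact HW.
  - now rewrite Hlen.
  - rewrite Hlen. intros [|i] Hi; [exact H0|]. simpl nth.
    destruct (Nat.lt_ge_cases i (m * m)) as [Hlt|Hge].
    + rewrite app_nth1, nth_row_major by (rewrite ?length_row_major; auto). apply (HA i Hlt).
    + rewrite app_nth2; rewrite length_row_major; [|lia]. rewrite nth_row_major by lia.
      rewrite <- HB by lia. f_equal. lia.
  - intros r f Hf. apply HQ; simpl.
    + intros x Hx. apply upd_neq. lia.
    + intros a i Ha. rewrite (proj2 (Nat.ltb_lt a 100)); auto.
    + intros t Ht. rewrite Hf by now rewrite length_row_major. now apply nth_row_major.
Qed.

Lemma runs_output (W : nat) (e : expr) (s : state) (Q : state -> Prop) :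
  fits (2 ^ W) s e -> 0 < W ->
  (forall s', reg s' 0 = 1 -> arr s' 0 0 = val s e -> Q s') ->
  runs W (output e) s (5 + cost e) Q.
Proof.
  intros He HW HQ. pose proof (pow2_gt1 W HW). unfold output. eapply runs_le.
  { eapply runs_seq. apply runs_store; [simpl; lia|exact He|].
    apply runs_assign; sim; [lia|lia|]. apply HQ; reflexivity. }
  sim. lia.
Qed.

Lemma runs_solve (mm : prog) (W N : nat) (D : list (list nat)) (G : cfg) (w : list nat)
    (s : state) (Q : state -> Prop) :
  let m := max_length D in
  is_dictionary (nsig G) D -> is_slp G -> generates G w ->
  (0 < m -> multiplies mm W m N) ->
  segment (arr s 0) 0 (encode_instance D G) -> 0 < W -> 2 < 2 ^ W ->
  (0 < m -> (total_length D + 3) * (nsig G + 1) < 2 ^ W /\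
     length (encode_instance D G) + 6 < 2 ^ W /\ (nvar G + 2) * (m * m) + 2 < 2 ^ W) ->
  (forall s', reg s' 0 = 1 -> arr s' 0 0 = Nat.b2n (asb (word_break w D)) -> Q s') ->
  runs W (solve mm) s
    (300 + 44 * length D + 28 * nsig G + total_length D * (84 + 14 * nsig G) +
     if m =? 0 then 0 else nvar G * (1000 + m * m * 720 + 4 * N)) Q.
Proof.
  intros m [Hnd Hlet] HG Hw Hmm Hseg HW HB2 HB HQ.
  pose proof Hseg as (_ & HK & Hrest). simpl in HK.
  assert (Htest : val s (Cond (EEq (Cell 0 (Num 1)) (Num 1)) (Cell 0 (Num 2)) (Cell 0 (Num 1))) = 0
                  <-> m = 0).
  { sim. rewrite HK. subst m. destruct D as [|d [|d' D]].
    - simpl. tauto.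
    - simpl in Hrest. destruct Hrest as [H2 _]. cbn [length]. rewrite Nat.eqb_refl. sim. cbn [Nat.b2n].
      sim. rewrite H2. unfold max_length. simpl. lia.
    - cbn [length]. pose proof (max_length_pos d d' D Hnd).
      change (S (S (length D)) =? 1) with false. cbn [Nat.b2n Nat.eqb]. lia. }
  eapply runs_le.
  { apply (runs_cond W _ _ _ _ (280 + 44 * length D + 28 * nsig G + total_length D * (84 + 14 * nsig G) +
     if m =? 0 then 0 else nvar G * (1000 + m * m * 720 + 4 * N))); [sim; lia| |]; intros Hc.
    - assert (Hm : 0 < m) by lia. specialize (Hmm Hm). destruct (HB Hm) as (B1 & B2 & B3).
      destruct (Nat.eqb_spec m 0) as [|_]; [lia|].
      unfold encode_instance in *. cbn [app] in *.
      pose proof Hseg as Hs. change (nsig G :: encode_dictionary D ++ encode_cfg G) with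
        ((nsig G :: encode_dictionary D) ++ encode_cfg G) in Hs. apply segment_app in Hs as [Hs1 Hs2].
      cbn [length] in B2, Hs2. rewrite length_app in B2.
      pose proof (length_encode_dictionary D) as HlD.
      eapply runs_le.
      { eapply runs_seq. apply (runs_build_trie W (nsig G) (arr s 0) D); auto; try lia.
        intros s1 (R1 & I1 & HT1) P1 M1 N1.
        eapply runs_seq. apply (runs_load_grammar W (arr s 0) G); auto; try (rewrite P1; auto; lia).
        intros s2 Ha2 R2 M2 N2 S2 Hst2.
        assert (E1 : arr s2 1 = arr s1 1) by (extensionality i; apply Ha2; lia).
        assert (E2 : arr s2 2 = arr s1 2) by (extensionality i; apply Ha2; lia).
        eapply runs_seq.
        apply (runs_evaluate mm W G m (reg s1 5) N D); auto; try congruence.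
        { apply max_length_forall. }
        { rewrite M2, M1. reflexivity. }
        { nia. }
        intros s3 (_ & _ & _ & Hmat) S3 R3.
        apply runs_output; auto; sim.
        { rewrite S3, R3. pose proof HG as [[(Hst & _) _] _]. nia. }
        intros s4 R4 O4. apply HQ; auto. rewrite O4, S3, R3.
        (* The answer is the entry [(0, 0)] of the matrix of the start symbol, the first cell of its
           row. *)
        pose proof (Hmat 0 ltac:(nia)) as H0. rewrite Nat.add_0_r in H0. rewrite H0.
        rewrite Nat.Div0.div_0_l, Nat.Div0.mod_0_l. f_equal. apply asb_iff.
        rewrite inner_break_zero, (expansion_start G w); auto. reflexivity. }
      sim. nia.
    - assert (Hm : m = 0) by now apply Htest.
      eapply runs_le.
      { apply runs_output; auto; [simpl; lia|]. intros s' H1 H2. apply HQ; auto. rewrite H2.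
        rewrite (proj2 (asb_false _)); auto. intros Hb.
        apply word_break_max0 in Hb; auto. subst w.
        pose proof HG as [[(Hst & _) _] _].
        pose proof (expansion_nonempty G (start G) HG Hst) as Hl.
        rewrite (expansion_start G [] HG Hw) in Hl. simpl in Hl. lia. }
      sim. destruct (m =? 0); lia. }
  sim. lia.
Qed.

(** * Real time bounds and word size *)

Lemma nat_bound (x : R) :
  exists N, (forall t, (INR t <= x)%R -> t <= N) /\ (INR N <= Rabs x)%R.
Proof.
  exists (Z.to_nat (up (Rabs x) - 1)). destruct (archimed (Rabs x)) as [H1 H2].
  pose proof (Rabs_pos x) as H0.
  assert (Hup : (0 < up (Rabs x))%Z) by (apply lt_IZR; lra).
  split.
  - intros t Ht. assert (H : (IZR (Z.of_nat t) < IZR (up (Rabs x)))%R).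
    { rewrite <- INR_IZR_INZ. pose proof (Rle_abs x). lra. }
    apply lt_IZR in H. lia.
  - rewrite INR_IZR_INZ, Z2Nat.id by lia. rewrite minus_IZR. lra.
Qed.

(** Here [omega] being at least 2 enters: the O(m^2) work on each nonterminal is dominated by matrix
    multiplication. *)
Lemma npow_square (n : nat) (omega : R) :
  (2 <= omega)%R -> 0 < n -> (INR (n * n) <= npow n omega)%R.
Proof.
  intros Ho Hn. unfold npow. destruct (Nat.eqb_spec n 0); [lia|].
  assert (H1 : (1 <= INR n)%R) by (change 1%R with (INR 1); apply le_INR; lia).
  replace (INR (n * n)) with (Rpower (INR n) 2).
  - apply Rle_Rpower; lra.
  - rewrite mult_INR. replace 2%R with (INR 2) by reflexivity.
    rewrite Rpower_pow by lra. simpl. ring.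
Qed.

Lemma npow_nonneg (n : nat) (omega : R) : (0 <= npow n omega)%R.
Proof.
  unfold npow. destruct (n =? 0); [lra|]. unfold Rpower. left. apply exp_pos.
Qed.

(* [1 + log2 (1 + L)] bits hold every word up to [L + 1], so a constant multiple
   of it provides any fixed power. *)
Lemma word_size_bounds (W L sig smax c0 M nv m : nat) :
  (4 * c0 + smax + 6) * (1 + Nat.log2 (1 + L)) <= W -> sig <= smax ->
  1 <= L -> M <= L -> nv <= L -> m <= L ->
  2 < 2 ^ W /\ (M + 3) * (sig + 1) < 2 ^ W /\ L + 6 < 2 ^ W /\
  (nv + 2) * (m * m) + 2 < 2 ^ W /\ c0 * (1 + Nat.log2 (2 + 2 * (m * m))) <= W.
Proof.
  intros HW Hs HL HM Hnv Hm. set (l := 1 + Nat.log2 (1 + L)) in *.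
  assert (HX : L + 1 < 2 ^ l).
  { pose proof (Nat.log2_spec (1 + L) ltac:(lia)) as [_ H]. unfold l.
    change (1 + Nat.log2 (1 + L)) with (S (Nat.log2 (1 + L))). lia. }
  assert (Hl : 1 <= l) by (unfold l; lia).
  set (X := 2 ^ l) in *.
  (* In the word size constant, 4 out of the 6 pay for the fourth power of [X], and [smax] pays for
     [sig + 1 <= X ^ smax]. *)
  assert (HB : X * X * X * X * (sig + 1) <= 2 ^ W).
  { assert (H1 : X * X * X * X * X ^ smax = 2 ^ (l * (4 + smax))).
    { rewrite Nat.pow_mul_r. fold X. clearbody X. rewrite Nat.pow_add_r.
      change (X ^ 4) with (X * (X * (X * (X * 1)))). generalize (X ^ smax). intros. ring. }
    assert (H2 : 2 ^ (l * (4 + smax)) <= 2 ^ W) by (apply Nat.pow_le_mono_r; nia).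
    assert (H3 : sig + 1 <= X ^ smax).
    { assert (smax < 2 ^ smax) by (apply Nat.pow_gt_lin_r; lia).
      assert (2 ^ smax <= X ^ smax) by (apply Nat.pow_le_mono_l; lia). lia. }
    nia. }
  (* The input of the multiplication has length below [X ^ 3], so its logarithm is at most [3 * l];
     hence the summand [4 * c0]. *)
  assert (HC : c0 * (1 + Nat.log2 (2 + 2 * (m * m))) <= W).
  { assert (H1 : 2 + 2 * (m * m) <= 2 ^ (3 * l)).
    { replace (2 ^ (3 * l)) with (X * X * X)
        by (rewrite (Nat.mul_comm 3 l), Nat.pow_mul_r; fold X; clearbody X; simpl; ring).
      assert (m * m + 1 <= X * X) by nia. assert (2 * (X * X) <= X * (X * X)) by nia. lia. }
    apply Nat.log2_le_mono in H1. rewrite Nat.log2_pow2 in H1 by lia. nia. }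
  set (B := 2 ^ W) in *. clearbody B X.
  assert (H2 : X * X * X * X <= B) by nia.
  assert (H3 : 3 * 3 * X <= X * X * X) by nia.
  assert (H4 : 3 * (X * X * X) <= X * X * X * X) by nia.
  repeat split.
  - nia.
  - assert (M + 3 <= X + 1) by lia.
    assert ((M + 3) * (sig + 1) <= (X + 1) * (sig + 1)) by nia.
    assert ((X + 1) * (sig + 1) < X * X * X * X * (sig + 1)) by nia. lia.
  - nia.
  - assert (m * m <= X * X) by nia.
    assert ((nv + 2) * (m * m) <= (X + 1) * (X * X)) by nia. nia.
  - exact HC.
Qed.

Theorem corollary4p1 (omega : R) (omega_ge2 : (2 <= omega)%R)
    (omega_matmul : matmul_exponent omega) :
  exists p : prog,
    forall sigma_max : nat,
    exists (c : nat) (C : R),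
      forall (D : list (list nat)) (G : cfg) (w : list nat),
        (nsig G <= sigma_max)%nat ->
        is_dictionary (nsig G) D ->
        is_slp G ->
        generates G w ->
        exists b : bool,
          (b = true <-> word_break w D) /\
          computes_within p c (encode_instance D G) (cons (Nat.b2n b) nil)
            (C * (1 + INR (total_length D)
                  + INR (size G) * npow (max_length D) omega))%R.
Proof.
  destruct omega_matmul as (p0 & c0 & C0 & Hp0).
  exists (solve (relocate p0)). intros smax.
  (* The first summand of the time constant covers the dictionary. The rest is per nonterminal: two
     visits with at most two products each are budgeted, hence the factor 4 of [Rabs C0], and 2000
     bounds the other work per [m * m]. The absolute value is taken because the sign of [C0] is
     unknown. *)
  exists (4 * c0 + smax + 6), (INR (400 + 28 * smax) + 2000 + 4 * Rabs C0)%R.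
  intros D G w Hsig HD HG Hw.
  exists (asb (word_break w D)). split; [apply asb_true|].
  intros W st HW Hwords [Hlen Hin].
  set (m := max_length D) in *. set (L := length (encode_instance D G)) in *.
  assert (HL : L = 1 + (1 + length D + total_length D) + length (encode_cfg G)).
  { unfold L, encode_instance. cbn [length]. rewrite length_app, length_encode_dictionary. lia. }
  pose proof (length_rules_le_encode G) as Hrl. pose proof (slp_nvar_le_rules G HG) as Hnr.
  pose proof (max_le_total D) as Hmt. fold m in Hmt.
  destruct (word_size_bounds W L (nsig G) smax c0 (total_length D) (nvar G) m HW Hsig)
    as (B2 & BM & BL & BN & BC); try lia.
  assert (HW0 : 0 < W) by (destruct W; [simpl in B2; lia|lia]).
  destruct (nat_bound (C0 * npow m omega)) as (N & HN & HNR).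
  destruct (runs_solve (relocate p0) W N D G w st
     (fun s' => reg s' 0 = 1 /\ arr s' 0 0 = Nat.b2n (asb (word_break w D))) HD HG Hw)
    with (st := st) as (t & st' & s' & E & Ht & (_ & _ & Hr & Ha) & Q0 & Q1); auto.
  { intros Hm. fold m in Hm. apply (multiplies_relocate p0 c0 W m N (C0 * npow m omega)); auto. }
  { apply segment_nth. exact Hin. }
  { split; [auto|]. split; [auto|]. split; auto. }
  exists t, st'. split; [exact E|]. split.
  { split.
    - rewrite Hr by lia. exact Q0.
    - intros i Hi. simpl in Hi. replace i with 0 by lia. rewrite Ha. exact Q1. }
  fold m in Ht.
  pose proof (length_le_total D (proj1 HD)) as HKM.
  pose proof (slp_nvar_le_size G HG) as Hnv.
  set (M := total_length D) in *.
  assert (Hms : M * nsig G <= smax * M) by (rewrite Nat.mul_comm; now apply Nat.mul_le_mono_r).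
  assert (Hlin : 300 + 44 * length D + 28 * nsig G + M * (84 + 14 * nsig G)
                 <= (400 + 28 * smax) * (1 + M)) by lia.
  pose proof (npow_nonneg m omega) as Hpn. pose proof (Rabs_pos C0) as HC0.
  assert (Hpart : (INR (if m =? 0 then 0 else nvar G * (1000 + m * m * 720 + 4 * N))
            <= (2000 + 4 * Rabs C0) * (INR (size G) * npow m omega))%R).
  (* For [m = 0] the left side vanishes along with [npow]; otherwise [1 <= m * m] absorbs the
     additive constant. *)
  { destruct (Nat.eqb_spec m 0) as [Hm|Hm].
    - simpl. apply Rmult_le_pos; [lra|]. apply Rmult_le_pos; [apply pos_INR|auto].
    - assert (Hsq : (INR (m * m) <= npow m omega)%R) by (apply npow_square; auto; lia).
      assert (Hnat : nvar G * (1000 + m * m * 720 + 4 * N) <= size G * (2000 * (m * m) + 4 * N)).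
      { apply Nat.mul_le_mono; [auto|]. nia. }
      apply le_INR in Hnat. eapply Rle_trans; [exact Hnat|].
      rewrite mult_INR, plus_INR, !mult_INR.
      rewrite Rabs_mult, (Rabs_pos_eq (npow m omega)) in HNR by auto.
      replace (INR 2000) with 2000%R by (rewrite INR_IZR_INZ; reflexivity).
      replace (INR 4) with 4%R by (rewrite INR_IZR_INZ; reflexivity).
      rewrite mult_INR in Hsq. pose proof (pos_INR (size G)) as Hsz.
      transitivity (INR (size G) * ((2000 + 4 * Rabs C0) * npow m omega))%R; [|right; ring].
      apply Rmult_le_compat_l; [auto|]. lra. }
  apply le_INR in Ht. eapply Rle_trans; [exact Ht|]. rewrite plus_INR.
  apply le_INR in Hlin. rewrite mult_INR, (plus_INR 1) in Hlin. simpl (INR 1) in Hlin.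
  set (A := INR (400 + 28 * smax)) in *. pose proof (pos_INR (400 + 28 * smax)) as HA. fold A in HA.
  set (P := (INR (size G) * npow m omega)%R) in *.
  assert (HP : (0 <= P)%R) by (apply Rmult_le_pos; [apply pos_INR|auto]).
  pose proof (pos_INR M) as HMp.
  assert (0 <= A * P)%R by (apply Rmult_le_pos; auto).
  assert (0 <= (2000 + 4 * Rabs C0) * (1 + INR M))%R by (apply Rmult_le_pos; lra).
  nra.
Qed.
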